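(* Let $k\in\mathbb N$, let $s\ge2$ be real, and suppose that $\Delta_s$ is an admissible exponent for $k$. Then for every $\varepsilon>0$ there exists $\eta>0$ such that, for all sufficiently large $P$, all $R$ with $2\le R\le P^\eta$ and all real $Q$ with $1\le Q\le P^{k/2}$, one has \[ \int_{\mathfrak M(Q,P)}|f(\alpha;P,R)|^s\,d\alpha\ll P^{s-k+\varepsilon}Q^{2\Delta_s/k}, \] with implied constant depending only on $\varepsilon,\eta,k,s$.
   Context: For real $P,R\ge1$, $\mathscr A(P,R)$ is the set of integers $n\in[1,P]$ all of whose prime divisors are at most $R$; $e(z)=e^{2\pi iz}$; $f(\alpha;P,R)=\sum_{x\in\mathscr A(P,R)}e(\alpha x^k)$; $U_s(P,R)=\int_0^1|f(\alpha;P,R)|^s\,d\alpha$. A real $\Delta_s$ is an admissible exponent (for $k$) if for every $\varepsilon>0$ there is $\eta>0$ (depending on $\varepsilon,k,s$) such that for $P$ sufficiently large and $1\le R\le P^\eta$ one has $U_s(P,R)\le C P^{s-k+\Delta_s+\varepsilon}$ with $C=C(\varepsilon,\eta,k,s)$. For $1\le Q\le P^{k/2}$, $\mathfrak M(Q,P)$ is the union over integers $1\le q\le Q$, $0\le a\le q$, $(a,q)=1$ of the sets $\{\alpha\in[0,1):|q\alpha-a|\le QP^{-k}\}$. *)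

(* Defs.v *)
From HB Require Import structures.
From mathcomp Require Import all_boot all_order all_algebra.
From mathcomp Require Import all_classical all_reals all_analysis.
Set Implicit Arguments. Unset Strict Implicit. Unset Printing Implicit Defensive.
Import Order.TTheory GRing.Theory Num.Theory.
Import numFieldNormedType.Exports.
Local Open Scope classical_set_scope.
Local Open Scope ring_scope.

Section Defs.
Variable R : realType.

Definition smoothb (P Rr : R) (n : nat) : bool :=
  [&& (1 <= n)%N, n%:R <= P & all (fun p : nat => p%:R <= Rr) (primes n)].

(* |f(alpha;P,R)| where f(alpha;P,R) = sum_{x in A(P,R)} e(alpha x^k),
   e(z) = cos(2 pi z) + i sin(2 pi z); the modulus is written out as
   sqrt(Re^2 + Im^2).  The range n < truncn P + 1 is merely an enumeration
   bound containing all n <= P. *)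
Definition fRe (k : nat) (P Rr alpha : R) : R :=
  \sum_(n < (Num.truncn P).+1 | smoothb P Rr n)
     cos (2 * pi * (alpha * (n%:R ^+ k))).
Definition fIm (k : nat) (P Rr alpha : R) : R :=
  \sum_(n < (Num.truncn P).+1 | smoothb P Rr n)
     sin (2 * pi * (alpha * (n%:R ^+ k))).
Definition fabs (k : nat) (P Rr alpha : R) : R :=
  Num.sqrt (fRe k P Rr alpha ^+ 2 + fIm k P Rr alpha ^+ 2).

Definition Us (k : nat) (s P Rr : R) : \bar R :=
  (\int[@lebesgue_measure R]_(alpha in `[0%R, 1%R]) ((fabs k P Rr alpha) `^ s)%:E)%E.

Definition admissible (k : nat) (s Delta : R) : Prop :=
  forall eps : R, 0 < eps ->
  exists eta : R, 0 < eta /\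
  exists C : R, exists P0 : R,
  forall P Rr : R, P0 <= P -> 1 <= Rr -> Rr <= P `^ eta ->
    (Us k s P Rr <= (C * P `^ (s - k%:R + Delta + eps))%:E)%E.

Definition major_arcs (k : nat) (Q P : R) : set R :=
  [set alpha | 0 <= alpha /\ alpha < 1 /\
     exists q a : nat, [/\ (1 <= q)%N, q%:R <= Q, (a <= q)%N, coprime a q &
        `|q%:R * alpha - a%:R| <= Q * (P ^+ k)^-1]].

Definition major_integral (k : nat) (s Q P Rr : R) : \bar R :=
  (\int[@lebesgue_measure R]_(alpha in major_arcs k Q P)
      ((fabs k P Rr alpha) `^ s)%:E)%E.

End Defs.

(* Main.v *)
(** The smooth numbers x > M factor uniquely as x = m w, where m collects the
    largest primes of x until the product first exceeds M, and the cofactor w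
    runs freely over the smooth numbers up to P/m with primes at most the least
    prime of m.  Hölder's inequality then bounds |f(alpha; P, R)|^s by an average
    of |f(alpha m^k; P/m, pi)|^s.  If alpha is close to a/q and
    g = gcd(q, m^k), then alpha m^k is close to a fraction of denominator q/g,
    each such fraction arising from at most g residues a, so that the mean value
    over M(Q, P) is controlled by those over M(Q/g, P/m).  Choosing P/m slightly
    above Q^(2/k) makes the arcs disjoint, and when g is small the admissible
    bound for the complete mean value applies.

    The loss g is paid for by weights in Hölder's inequality that favour those m
    having a large common part with q; when g is large one inducts on Q, and the
    sum over g gains a power because Delta >= k - s/2.  The last inequality holds
    for every admissible exponent, by Parseval's identity and a lower bound for the
    number of Z-smooth integers up to Z^t. *)

(* The scale [Y], a small power of P, holds the argument together. After a decomposition every sum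
   has length N = P/m at least the larger of 4 Q^(2/k) and [Y]: the first bound makes the arcs
   disjoint, the second keeps the smoothness parameter below N^eta0, so that admissibility can be
   used at length N.

   One pass of the recursion loses L = 4^s Psi^s Rmax^s, where Psi bounds the number of integers, up
   to a power of P, composed of the primes of a given integer; L is a power of P as small as wished.
   The induction hypothesis is invoked only for g^e > Y, and there it gains Y^(-1/2), which
   outweighs L; hence the constant does not grow along the induction.

   The exponent is e = 1 - (s-1)/k: 1 from the residues sharing a fraction, the rest from the
   weights. The hypothesis at Q/g adds -2 Delta/k, and Delta >= k - s/2 makes the total at most -1 +
   1/k, so at most -1/2 for k >= 2. If s >= k + 1, as always for k = 1, then e <= 0 and no g is
   large in this sense. Without weights the total would be 1 - 2 Delta/k, which is positive for
   small Delta. *)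
Require Import Defs.
From HB Require Import structures.
From mathcomp Require Import all_boot all_order all_algebra.
From mathcomp Require Import all_classical all_reals all_analysis.
From mathcomp Require Import ring lra zify.
Import Order.TTheory GRing.Theory Num.Theory.
Import numFieldNormedType.Exports.
Local Open Scope classical_set_scope.
Local Open Scope ring_scope.

(** * Integrals of continuous functions over segments *)

Section Int.
Variable R : realType.
Notation mu := (@lebesgue_measure R).

(** An unoriented integral: for b < a the segment is empty and the value is 0. *)
Definition Int (h : R -> R) (a b : R) : R := \int[mu]_(x in `[a, b]) h x.

Lemma Int_integrable (h : R -> R) a b :
  continuous h -> mu.-integrable `[a, b] (EFin \o h).
Proof.
move=> ch; apply: continuous_compact_integrable; first exact: segment_compact.
exact: continuous_subspaceT.
Qed.

Lemma EFin_Int (h : R -> R) a b : continuous h ->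
  (\int[mu]_(x in `[a, b]) (h x)%:E)%E = (Int h a b)%:E.
Proof.
by move=> ch; rewrite fineK//; apply: integrable_fin_num => //; apply: Int_integrable.
Qed.

Lemma le_Int (h g : R -> R) a b : continuous h -> continuous g ->
  (forall x, a <= x <= b -> h x <= g x) -> Int h a b <= Int g a b.
Proof.
move=> ch cg hg; apply: le_Rintegral => //; try exact: Int_integrable.
Qed.

Lemma Int_ge0 (h : R -> R) a b : (forall x, 0 <= h x) -> 0 <= Int h a b.
Proof. by move=> h0; apply: Rintegral_ge0 => x _. Qed.

Lemma eq_Int (h g : R -> R) a b : h =1 g -> Int h a b = Int g a b.
Proof. by move=> hg; apply: eq_Rintegral => x _. Qed.

Lemma IntD (h g : R -> R) a b : continuous h -> continuous g ->
  Int (fun x => h x + g x) a b = Int h a b + Int g a b.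
Proof. by move=> ch cg; apply: RintegralD => //; exact: Int_integrable. Qed.

Lemma IntZ (c : R) (h : R -> R) a b : continuous h ->
  Int (fun x => c * h x) a b = c * Int h a b.
Proof. by move=> ch; apply: RintegralZl => //; exact: Int_integrable. Qed.

Lemma Int_cst (c : R) a b : a <= b -> Int (fun=> c) a b = c * (b - a).
Proof.
move=> ab; rewrite /Int Rintegral_cst//= lebesgue_measure_itv/= lte_fin.
by case: ltP => //= ba; rewrite (_ : b = a) ?subrr//; apply/le_anti; rewrite ab ba.
Qed.

Lemma continuous_sumf (I : Type) (r : seq I) (P : pred I) (F : I -> R -> R) :
  (forall i, P i -> continuous (F i)) ->
  continuous (fun x => \sum_(i <- r | P i) F i x).
Proof.
move=> cF; elim: r => [|i r IH].
  by under eq_fun do rewrite big_nil; exact: cst_continuous.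
under eq_fun do rewrite big_cons.
case Pi: (P i) => //= x; apply: cvgD; [exact: cF | exact: IH].
Qed.

Lemma Int_sum (I : Type) (r : seq I) (P : pred I) (F : I -> R -> R) a b :
  (forall i, P i -> continuous (F i)) ->
  Int (fun x => \sum_(i <- r | P i) F i x) a b =
  \sum_(i <- r | P i) Int (F i) a b.
Proof.
move=> cF; elim: r => [|i r IH].
  rewrite big_nil; under eq_Int do rewrite big_nil.
  by rewrite /Int /Rintegral integral0.
rewrite big_cons; under eq_Int do rewrite big_cons.
case Pi: (P i) => //; rewrite IntD ?IH//; first exact: cF.
exact: continuous_sumf.
Qed.

Lemma continuous_affine (h : R -> R) (K c : R) :
  continuous h -> continuous (fun x => h (K * x + c)).
Proof.
move=> ch x; apply: continuous_comp; last exact: ch.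
apply: cvgD; last exact: cvg_cst.
by apply: cvgM; [exact: cvg_cst|exact: cvg_id].
Qed.

Lemma is_derive_affine (K c x : R) : is_derive x 1 (fun x : R => K * x + c) K.
Proof.
rewrite (_ : K = K *: 1 + 0); last by rewrite addr0 /GRing.scale/= mulr1.
have -> : (fun x : R => (K *: 1 + 0) * x + c) = (K *: (@idfun R : R -> R^o)) + cst c.
  by apply/funext => y; rewrite addr0 /GRing.scale/= mulr1.
by apply: is_deriveD.
Qed.

Lemma Int_affine (h : R -> R) (K c a b : R) : continuous h -> 0 < K -> a <= b ->
  Int h (K * a + c) (K * b + c) = K * Int (fun x => h (K * x + c)) a b.
Proof.
move=> ch K0 ab; apply: EFin_inj.
have dF := is_derive_affine K c.
have dE : derive1 (fun x : R => K * x + c) = fun=> K.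
  by apply/funext => x; rewrite derive1E; apply: derive_val.
rewrite -IntZ; last exact: continuous_affine.
rewrite -!EFin_Int//; last first.
  move=> x; apply: cvgM; first exact: cvg_cst.
  exact: continuous_affine.
rewrite (integration_by_substitution_increasing (F := fun x => K * x + c))//.
- by apply: eq_integral => x _; rewrite /= dE mulrC.
- by move=> x y _ _ xy; rewrite ltrD2r ltr_pM2l.
- by rewrite dE => x _; exact: cst_continuous.
- by rewrite dE; exact: is_cvg_cst.
- by rewrite dE; exact: is_cvg_cst.
- have cF : continuous (fun x : R => K * x + c) := continuous_affine id K c (fun x => cvg_id).
  by split => //; [apply: cvg_at_right_filter|apply: cvg_at_left_filter]; exact: cF.
- exact: continuous_subspaceT.
Qed.

Lemma Int_shift_nat (h : R -> R) (n : nat) a b : continuous h ->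
  (forall x, h (x + 1) = h x) -> Int h (a + n%:R) (b + n%:R) = Int h a b.
Proof.
move=> ch hp; have [ab|ba] := leP a b; last first.
  by rewrite /Int !set_itv_ge ?bnd_simp -?ltNge ?ltrD2r// !Rintegral_set0.
rewrite -[a]mul1r -[b]mul1r Int_affine// mul1r !mul1r; apply: eq_Int => x.
elim: n => [|n IH]; first by rewrite mul1r addr0.
by rewrite -natr1 addrA hp.
Qed.

Lemma Int_packing (I : choiceType) (r : seq I) (u v : I -> R) (h : R -> R) a b :
  continuous h -> (forall x, 0 <= h x) -> uniq r ->
  (forall i, i \in r -> a <= u i /\ v i <= b) ->
  (forall i j, i \in r -> j \in r -> i != j -> v i < u j \/ v j < u i) ->
  \sum_(i <- r) Int h (u i) (v i) <= Int h a b.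
Proof.
move=> ch h0 ur sub dis; rewrite -lee_fin -sumEFin.
under eq_bigr do rewrite -EFin_Int//.
have mh : measurable_fun setT h by exact: measurable_realfun.continuous_measurable_fun.
have tI : trivIset [set` r] (fun i => `[u i, v i]%classic).
  apply/trivIsetP => i j /= ir jr ij; rewrite -subset0 => x [] /=.
  by rewrite !in_itv/=; have [] := dis i j ir jr ij; lra.
have := @ge0_integral_bigsetU _ _ _ mu I (fun i => `[u i, v i]%classic)
  (EFin \o h) r (fun=> measurable_itv _) ur tI.
move=> /= <-; last by move=> x _; rewrite lee_fin.
- rewrite -EFin_Int//; apply: ge0_subset_integral => //.
  + exact: bigsetU_measurable.
  + by apply/measurable_realfun.measurable_EFinP; exact: measurable_funTS.
  + by move=> x _; rewrite lee_fin.
  + rewrite -bigcup_seq => x [i /= ir] /=; rewrite !in_itv/=.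
    by have [? ?] := sub i ir; lra.
- by apply/measurable_realfun.measurable_EFinP; exact: measurable_funTS.
Qed.

(** Arcs around points of [0, 1] with half-width at most 1 may leave the unit period but stay in
    [-1, 2]; this is the source of the factor 3. *)
Lemma Int_period3 (h : R -> R) : continuous h -> (forall x, 0 <= h x) ->
  (forall x, h (x + 1) = h x) -> Int h (-1) 2 = 3 * Int h 0 1.
Proof.
move=> ch h0 hp.
have split a b c : a <= b -> b <= c -> Int h a c = Int h a b + Int h b c.
  move=> ab bc; rewrite /Int.
  have := @Rintegral_itvB R h (BLeft a) (BRight c) b (Int_integrable h a c ch).
  rewrite !bnd_simp => /(_ ab bc) E.
  rewrite Rintegral_itv_obnd_cbnd in E; first by rewrite -E addrC subrK.
  by apply: integrableS (Int_integrable h b c ch) => //; exact: subset_itv_oc_cc.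
rewrite (split _ 0 2) ?(split 0 1 2); try lra.
have := Int_shift_nat h 1 (-1) 0 ch hp; have := Int_shift_nat h 1 0 1 ch hp.
rewrite add0r -[1%:R]/(1 : R) addNr -[1 + 1]/(2%:R : R).
lra.
Qed.

End Int.

(** * Sums over major arcs *)

Section Arcs.
Variable R : realType.
Implicit Types (h : R -> R) (Q T : R).

(* The arcs |q alpha - a| <= Q / T with a running over the residues mod q;
   the major arcs of the paper have T = P^k. *)
Definition arcq h Q T (q : nat) : R :=
  \sum_(a < q | coprime a q)
    Int R h (a%:R / q%:R - Q / (q%:R * T)) (a%:R / q%:R + Q / (q%:R * T)).

(** Overlapping arcs are counted with multiplicity. This keeps the recursion free of disjointness
    conditions; only [arcsum_disjoint] needs one. *)
Definition arcsum h Q T : R :=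
  \sum_(q < (Num.truncn Q).+1 | (0 < q)%N) arcq h Q T q.

Lemma arcsum_ge0 h Q T : (forall x, 0 <= h x) -> 0 <= arcsum h Q T.
Proof.
by move=> h0; apply: sumr_ge0 => q _; apply: sumr_ge0 => a _; apply: Int_ge0.
Qed.

(** If a r = b q, coprimality gives q | r and r | q, and the two fractions coincide. In integers the
    strict inequality means a difference of at least 1, which [arcs_apart] exploits. *)
Lemma fracs_spaced (a q b r : nat) : (0 < q)%N -> (0 < r)%N ->
  coprime a q -> coprime b r -> (a < q)%N -> (b < r)%N -> (q, a) != (r, b) ->
  (a * r < b * q)%N \/ (b * q < a * r)%N.
Proof.
move=> q0 r0 aq br ltaq ltbr; have [? _|? _|E] := ltngtP (a * r)%N (b * q)%N.
- by left.
- by right.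
have qr : (q %| r)%N.
  by rewrite -(@Gauss_dvdr q a r) ?E ?dvdn_mull// coprime_sym.
have rq : (r %| q)%N.
  by rewrite -(@Gauss_dvdr r b q) -?E ?dvdn_mull// coprime_sym.
have e : q = r by apply/eqP; rewrite eqn_dvd qr.
by move: E; rewrite e => /eqP; rewrite eqn_pmul2r// => /eqP ->; rewrite eqxx.
Qed.

(** After multiplication by q r T the centres differ by at least T, while the two half-widths add up
    to Q (q + r) <= 2 Q^2 < T. *)
Lemma arcs_apart Q T (a q b r : nat) : 1 <= Q -> 2 * Q ^+ 2 < T ->
  (0 < q)%N -> (0 < r)%N -> q%:R <= Q -> r%:R <= Q -> (a * r < b * q)%N ->
  a%:R / q%:R + Q / (q%:R * T) < b%:R / r%:R - Q / (r%:R * T).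
Proof.
move=> Q1 QT q0 r0 qQ rQ lt.
have T0 : 0 < T by apply: le_lt_trans QT; rewrite mulr_ge0// sqr_ge0.
have q0' : (0 : R) < q%:R by rewrite ltr0n.
have r0' : (0 : R) < r%:R by rewrite ltr0n.
have lt' : (a%:R * r%:R : R) + 1 <= b%:R * q%:R.
  by rewrite -!natrM natr1 ler_nat.
rewrite -(ltr_pM2r q0') -(ltr_pM2r r0') -(ltr_pM2r T0).
have -> : (a%:R / q%:R + Q / (q%:R * T)) * q%:R * r%:R * T =
   (a%:R * r%:R) * T + Q * r%:R by field; lra.
have -> : (b%:R / r%:R - Q / (r%:R * T)) * q%:R * r%:R * T =
   (b%:R * q%:R) * T - Q * q%:R by field; lra.
nra.
Qed.

Lemma arcsum_disjoint h Q T : continuous h -> (forall x, 0 <= h x) ->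
  (forall x, h (x + 1) = h x) -> 1 <= Q -> 2 * Q ^+ 2 < T ->
  arcsum h Q T <= 3 * Int R h 0 1.
Proof.
move=> ch h0 hp Q1 QT; rewrite -Int_period3//.
have T0 : 0 < T by apply: le_lt_trans QT; rewrite mulr_ge0// sqr_ge0.
set n := (Num.truncn Q).+1.
pose u (x : 'I_n * 'I_n) := (x.2%:R / x.1%:R - Q / (x.1%:R * T) : R).
pose v (x : 'I_n * 'I_n) := (x.2%:R / x.1%:R + Q / (x.1%:R * T) : R).
pose p (x : 'I_n * 'I_n) := [&& (0 < x.1)%N, coprime x.2 x.1 & (x.2 < x.1)%N].
have -> : arcsum h Q T = \sum_(x | p x) Int R h (u x) (v x).
  rewrite /arcsum -/n /arcq.
  rewrite (eq_bigr (fun q : 'I_n => \sum_(a < n | coprime a q && (a < q)%N)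
     Int R h (a%:R / q%:R - Q / (q%:R * T)) (a%:R / q%:R + Q / (q%:R * T)))); last first.
    move=> q _; rewrite (big_ord_widen_cond n (fun a => coprime a q)
      (fun a => Int R h (a%:R / q%:R - Q / (q%:R * T)) (a%:R / q%:R + Q / (q%:R * T))))//.
    exact: ltnW.
  by rewrite pair_big_dep.
have inQ (x : 'I_n) : (x%:R : R) <= Q.
  by rewrite -truncn_ge_nat ?(le_trans ler01)// -ltnS.
rewrite -big_filter; apply: Int_packing => //.
- exact/filter_uniq/index_enum_uniq.
- move=> [q a]; rewrite mem_filter => /andP[/and3P[/= q0 _ aq] _].
  rewrite /u /v /=.
  have q1 : (1 : R) <= q%:R by rewrite ler1n.
  have aq' : (a%:R : R) <= q%:R by rewrite ler_nat ltnW.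
  have ? : a%:R / q%:R <= 1 :> R by rewrite ler_pdivrMr ?mul1r// (lt_le_trans ltr01).
  have ? : 0 <= a%:R / q%:R :> R by rewrite divr_ge0.
  have ? : Q / (q%:R * T) <= 1.
    by rewrite ler_pdivrMr ?mul1r ?mulr_gt0 ?(lt_le_trans ltr01 q1)//; nra.
  lra.
- move=> [q a] [r b]; rewrite !mem_filter => /andP[/and3P[/= q0 caq aq] _].
  move=> /andP[/and3P[/= r0 cbr br] _] ne; rewrite /u /v /=.
  have [] := @fracs_spaced a q b r q0 r0 caq cbr aq br.
  + by apply: contraNneq ne => -[? ?]; apply/eqP; congr pair; apply: val_inj.
  + by move=> lt; left; apply: arcs_apart.
  + by move=> lt; right; apply: arcs_apart.
Qed.

Lemma sum_modn (F : nat -> R) (g q : nat) : (0 < q)%N ->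
  \sum_(0 <= a < g * q) F (a %% q)%N = g%:R * \sum_(0 <= c < q) F c.
Proof.
move=> q0; elim: g => [|g IH]; first by rewrite mul0n big_geq// mul0r.
rewrite (big_cat_nat (n := (g * q)%N))//=; last by rewrite mulSn leq_addl.
rewrite IH -natr1 mulrDl mul1r; congr (_ + _).
rewrite -{1}[(g * q)%N]add0n big_addn mulSn addnK.
by rewrite !big_nat; apply: eq_bigr => i iq; rewrite addnC modnMDl modn_small.
Qed.

(** Multiplication by a unit l permutes the residues mod q and preserves the units. *)
Lemma sum_units_mul (phi : nat -> R) (l q : nat) : (0 < q)%N -> coprime l q ->
  \sum_(c < q | coprime c q) phi ((l * c) %% q)%N =
  \sum_(b < q | coprime b q) phi b.
Proof.
move=> q0 lq; pose f (c : 'I_q) := Ordinal (ltn_pmod (l * c) q0).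
rewrite [RHS](reindex_inj (h := f)) /=.
  by apply: eq_bigl => c; rewrite coprime_modl coprimeMl lq.
have inj (c d : 'I_q) : (c <= d)%N -> (l * c = l * d %[mod q])%N -> c = d.
  move=> cd /eqP; rewrite eq_sym eqn_mod_dvd ?leq_mul2l ?cd ?orbT// -mulnBr.
  rewrite Gauss_dvdr 1?coprime_sym// => dv.
  apply: val_inj => /=; have := @dvdn_leq q (d - c)%N; have := ltn_ord d; lia.
move=> c d /(congr1 val) /= E; case/orP: (leq_total c d) => cd; first exact: inj.
by apply/esym/inj.
Qed.

(* With r = q / g and l = K / g, the point K a / q is l a / r, and a |-> l a mod r
   maps units mod q to units mod r, at most g to one. *)
Lemma arcq_scale h Q T (K g q : nat) : continuous h -> (forall x, 0 <= h x) ->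
  (forall x, h (x + 1) = h x) -> (0 < K)%N -> (0 < q)%N -> 0 < T -> 0 < Q ->
  gcdn q K = g ->
  arcq (fun x => h (K%:R * x)) Q T q <=
    g%:R / K%:R * arcq h (Q / g%:R) (T / K%:R) (q %/ g).
Proof.
move=> ch h0 hp K0 q0 T0 Q0 gE.
have g0 : (0 < g)%N by rewrite -gE gcdn_gt0 q0.
have [gq gK] : (g %| q)%N /\ (g %| K)%N by rewrite -gE dvdn_gcdl dvdn_gcdr.
set r := (q %/ g)%N; set l := (K %/ g)%N.
have qE : q = (g * r)%N by rewrite mulnC divnK.
have KE : K = (g * l)%N by rewrite mulnC divnK.
have r0 : (0 < r)%N by move: q0; rewrite qE muln_gt0 => /andP[].
have lr : coprime l r.
  rewrite /coprime -(eqn_pmul2l g0) muln_gcdr -qE -KE muln1 gcdnC; exact/eqP.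
have [q0' K0' g0' r0'] : [/\ 0 < q%:R :> R, 0 < K%:R :> R, 0 < g%:R :> R & 0 < r%:R :> R].
  by rewrite !ltr0n.
have l0' : 0 < l%:R :> R by rewrite ltr0n; move: K0; rewrite KE muln_gt0 => /andP[].
(* Half-width of the arcs of denominator r at the scaled parameters. It equals K Q / (q T), the
   half-width for q stretched by x |-> K x. *)
pose w := Q / g%:R / (r%:R * (T / K%:R)).
have w0 : 0 < w by rewrite !(divr_gt0, mulr_gt0).
pose phi (b : nat) := Int R h (b%:R / r%:R - w) (b%:R / r%:R + w).
have qR : q%:R = g%:R * r%:R :> R by rewrite -natrM -qE.
have KR : K%:R = g%:R * l%:R :> R by rewrite -natrM -KE.
have stepa (a : nat) : Int R (fun x => h (K%:R * x))
    (a%:R / q%:R - Q / (q%:R * T)) (a%:R / q%:R + Q / (q%:R * T)) =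
    K%:R^-1 * phi ((l * (a %% r)) %% r)%N.
  have d0 : 0 < Q / (q%:R * T) by rewrite divr_gt0// mulr_gt0.
  rewrite modnMmr.
  apply: (mulfI (lt0r_neq0 K0')); rewrite mulrA divff ?gt_eqF// mul1r.
  rewrite (eq_Int _ _ (fun x => h (K%:R * x + 0))); last by move=> x; rewrite addr0.
  rewrite -Int_affine//; last lra.
  rewrite !addr0 /phi -[RHS](Int_shift_nat _ _ (l * a %/ r))//.
  have E : (l%:R * a%:R : R) = (l * a %/ r)%:R * r%:R + (l * a %% r)%:R.
    by rewrite -!natrM -natrD -divn_eq.
  have -> : K%:R * (a%:R / q%:R - Q / (q%:R * T)) =
      (l%:R * a%:R) / r%:R - w.
    rewrite /w KR qR; field.
    by rewrite !gt_eqF.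
  have -> : K%:R * (a%:R / q%:R + Q / (q%:R * T)) =
      (l%:R * a%:R) / r%:R + w.
    rewrite /w KR qR; field.
    by rewrite !gt_eqF.
  by rewrite E; apply: (congr2 (Int R h)); field; rewrite gt_eqF.
rewrite {1}/arcq; under eq_bigr do rewrite stepa.
rewrite -mulr_sumr [leRHS]mulrAC [leRHS]mulrC ler_pM2l ?invr_gt0//.
(* A numerator prime to q is prime to r. Keeping only the latter condition enlarges the sum and
   makes it depend on a mod r alone; as q = g r, each residue mod r occurs exactly g times. *)
pose F c := if coprime c r then phi ((l * c) %% r)%N else 0.
apply: (@le_trans _ _ (\sum_(a < q) F (a %% r)%N)).
  rewrite big_mkcond/=; apply: ler_sum => a _; rewrite /F.
  case: ifPn => [aq|_].
    by rewrite coprime_modl (coprime_dvdr _ aq)// qE dvdn_mull.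
  by case: ifP => // _; apply: Int_ge0.
rewrite -(big_mkord xpredT (fun a => F (a %% r)%N)) {1}qE sum_modn// ler_pM2l//.
by rewrite big_mkord -big_mkcond/= sum_units_mul.
Qed.

(** On multiples of g the map q |-> q/g is injective and lands in the range up to Q/g, so
    [arcq_scale] can be summed without further loss. *)
Lemma arcsum_scale h Q T (K g : nat) : continuous h -> (forall x, 0 <= h x) ->
  (forall x, h (x + 1) = h x) -> (0 < K)%N -> 0 < T -> 0 < Q -> (0 < g)%N ->
  \sum_(q < (Num.truncn Q).+1 | (0 < q)%N && (gcdn q K == g))
     arcq (fun x => h (K%:R * x)) Q T q <=
  g%:R / K%:R * arcsum h (Q / g%:R) (T / K%:R).
Proof.
move=> ch h0 hp K0 T0 Q0 g0.
have arcq0 Q' T' q : 0 <= arcq h Q' T' q.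
  by apply: sumr_ge0 => a _; apply: Int_ge0.
have g0' : (0 : R) < g%:R by rewrite ltr0n.
apply: (@le_trans _ _ (\sum_(q < (Num.truncn Q).+1 | (0 < q)%N && (gcdn q K == g))
   g%:R / K%:R * arcq h (Q / g%:R) (T / K%:R) (q %/ g)%N)).
  by apply: ler_sum => q /andP[q0 /eqP gE]; exact: arcq_scale.
rewrite -mulr_sumr ler_wpM2l ?divr_ge0//.
set n := (Num.truncn Q).+1; set m := (Num.truncn (Q / g%:R)).+1.
have qm (q : 'I_n) : (q %/ g < m)%N.
  rewrite ltnS truncn_ge_nat; last by rewrite ltW// divr_gt0.
  rewrite ler_pdivlMr// -natrM.
  apply: (@le_trans _ _ q%:R); first by rewrite ler_nat leq_divM.
  by rewrite -truncn_ge_nat -1?ltnS// ltW.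
pose f (q : 'I_n) := Ordinal (qm q).
rewrite /arcsum -/m.
rewrite (partition_big f (fun r : 'I_m => (0 < r)%N))/=; last first.
  move=> q /andP[q0 /eqP gE]; rewrite divn_gt0// dvdn_leq// -gE dvdn_gcdl//.
apply: ler_sum => r r0.
rewrite (eq_bigr (fun=> arcq h (Q / g%:R) (T / K%:R) r)); last first.
  by move=> q /andP[_ /eqP <-].
rewrite sumr_const; set A := #|_|; have : (A <= 1)%N.
  apply/card_le1_eqP => x y /andP[/andP[x0 /eqP gx] /eqP fx].
  move=> /andP[/andP[y0 /eqP gy] /eqP fy]; apply: val_inj => /=.
  have [gdx gdy] : (g %| x)%N /\ (g %| y)%N by rewrite -{1}gx -gy !dvdn_gcdl.
  by rewrite -(divnK gdx) -(divnK gdy); congr muln; move: fy; rewrite -fx => /(congr1 val).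
case: A => [|[|]]// _; rewrite ?mulr0n//.
Qed.

End Arcs.

(** * Counting integers composed of the primes of q *)

Section Rankin.
Variable R : realType.

Lemma ler_sum_inj (I J : finType) (P : pred I) (Q : pred J) (f : I -> J)
    (F : I -> R) (G : J -> R) :
  (forall i, P i -> Q (f i)) ->
  (forall i i', P i -> P i' -> f i = f i' -> i = i') ->
  (forall i, P i -> F i <= G (f i)) -> (forall j, Q j -> 0 <= G j) ->
  \sum_(i | P i) F i <= \sum_(j | Q j) G j.
Proof.
move=> PQ inj FG G0; rewrite (partition_big f Q)//; apply: ler_sum => j Qj.
apply: (@le_trans _ _ (\sum_(i | P i && (f i == j)) G j)).
  by apply: ler_sum => i /andP[Pi /eqP <-]; exact: FG.
rewrite sumr_const; set A := #|_|; have : (A <= 1)%N.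
  apply/card_le1_eqP => x y /andP[Px /eqP fx] /andP[Py /eqP fy].
  by apply: inj => //; rewrite fx fy.
by case: A => [|[|]]// _; rewrite ?mulr0n// G0.
Qed.

Lemma powR_ge1 (x a : R) : 1 <= x -> 0 <= a -> 1 <= x `^ a.
Proof. by move=> x1 a0; rewrite -(powRr0 x); apply: ler_powR. Qed.

Lemma powR_div (x y a : R) : 0 <= x -> 0 < y -> (x / y) `^ a = x `^ a / y `^ a.
Proof.
move=> x0 y0; apply: (mulIf (lt0r_neq0 (powR_gt0 a y0))).
have xy : 0 <= x / y by rewrite divr_ge0// ltW.
by rewrite -(powRM _ xy (ltW y0)) !divfK// gt_eqF// powR_gt0.
Qed.

Lemma powR_le1 (x a : R) : 1 <= x -> a <= 0 -> x `^ a <= 1.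
Proof. by move=> x1 a0; rewrite -[leRHS](powRr0 x); apply: ler_powR. Qed.

(** Write m = d j with d the part of m built from the primes of q. For each d there are at most X/d
    values of j, and each has weight d, so d contributes at most X. *)
Lemma sum_partn_le (q X : nat) :
  \sum_(m < X.+1 | (0 < m)%N) (m`_(\pi(q)))%:R <=
  X%:R * \sum_(d < X.+1 | (0 < d)%N && \pi(q).-nat d) (1 : R).
Proof.
rewrite mulr_sumr.
apply: (@le_trans _ _ (\sum_(d < X.+1 | (0 < d)%N && \pi(q).-nat d)
    \sum_(j < X.+1 | (0 < j)%N && (d * j <= X)%N) d%:R)); last first.
  apply: ler_sum => d /andP[d0 _]; rewrite mulr1.
  apply: (@le_trans _ _ (\sum_(j < X %/ d) d%:R)).
    have [n0|n0] := posnP (X %/ d).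
      rewrite big_pred0 ?sumr_ge0// => j; apply/negbTE/negP => /andP[j0 dj].
      have : (d <= X)%N by rewrite (leq_trans _ dj)// leq_pmulr.
      by rewrite -divn_gt0// n0.
    case E : (X %/ d)%N n0 => [//|n] _.
    apply: (@ler_sum_inj _ _ _ _ (fun j : 'I_X.+1 => inord j.-1)) => //.
    move=> i j /andP[i0 di] /andP[j0 dj] /(congr1 (@nat_of_ord _)).
    have lt (u : 'I_X.+1) : (0 < u)%N -> (d * u <= X)%N -> (u.-1 < n.+1)%N.
      by move=> u0 du; rewrite prednK// -E leq_divRL// mulnC.
    by rewrite !inordK ?lt// => ?; apply: val_inj => /=; lia.
  by rewrite sumr_const card_ord -mulrnA ler_nat mulnC leq_divM.
rewrite pair_big_dep /=.
have lt (u : 'I_X.+1) v : (v <= u)%N -> (v < X.+1)%N.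
  by move=> vu; rewrite (leq_ltn_trans vu)// ltn_ord.
have pl (m : 'I_X.+1) (m0 : (0 < m)%N) pi : (m`_pi < X.+1)%N.
  by apply: (lt m); rewrite dvdn_leq// dvdn_part.
refine (@ler_sum_inj _ ('I_X.+1 * 'I_X.+1)%type _ _ (fun m : 'I_X.+1 =>
   (inord (m`_(\pi(q)))%N, inord (m`_(\pi(q)^'))%N)) _ _ _ _ _ _).
- move=> m m0; rewrite /= !inordK ?pl// !part_gt0 part_pnat/=.
  by rewrite partnC// -ltnS.
- move=> i j i0 j0 [] /(congr1 (@nat_of_ord _)) + /(congr1 (@nat_of_ord _)).
  rewrite !inordK ?pl// => E1 E2; apply: val_inj => /=.
  by rewrite -(partnC (\pi(q)) i0) -(partnC (\pi(q)) j0) E1 E2.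
- by move=> m m0 /=; rewrite inordK ?pl.
- by [].
Qed.
Variable e : R.
Hypothesis e0 : 0 < e.

Lemma powRN_lt1 (p : nat) : (1 < p)%N -> 0 < (p%:R : R) `^ (- e) < 1.
Proof.
move=> p1; have p0 : 0 < (p%:R : R) by rewrite ltr0n ltnW.
rewrite powR_gt0//= powRN invf_lt1 ?powR_gt0//.
by rewrite -[ltLHS](congr1 (fun f => f e) (powR1 R)) gt0_ltr_powR ?nnegrE ?ltr1n// ltW.
Qed.

(* Rankin: splitting off the multiples of p gives S(p :: ps) <= S(ps) + p^-e S(p :: ps). *)
Lemma rankin_seq (ps : seq nat) (X : nat) : all prime ps -> uniq ps ->
  \sum_(d < X.+1 | (0 < d)%N && all (mem ps) (primes d)) (d%:R `^ (- e) : R) <=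
  \prod_(p <- ps) (1 - p%:R `^ (- e))^-1.
Proof.
elim: ps => [_ _|p ps IH /= /andP[pp pps] /andP[nps ups]].
  rewrite big_nil; apply: (@le_trans _ _ (\sum_(j < 1) 1)); last first.
    by rewrite big_ord1.
  apply: (@ler_sum_inj _ _ _ xpredT (fun=> ord0)) => // [i j|i].
    move=> /andP[i0 pi] /andP[j0 pj] _; apply: val_inj => /=.
    suff H (n : nat) : (0 < n)%N -> all (mem [::]) (primes n) -> n = 1%N.
      by rewrite (H i)// (H j).
    case: n => [|[|n]]// _ /allP /(_ (pdiv n.+2)).
    by rewrite mem_primes pdiv_prime// pdiv_dvd /= => /(_ isT).
  move=> /andP[i0 pi]; apply: powR_le1; first by rewrite ler1n.
  by rewrite oppr_le0 ltW.
set S := (X in X <= _).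
have p1 := prime_gt1 pp; have /andP[c0 c1] := powRN_lt1 p p1.
set c := p%:R `^ (- e) in c0 c1 *.
rewrite big_cons mulrC ler_pdivlMr ?subr_gt0//.
apply: le_trans (IH pps ups).
suff : S <= \sum_(d < X.+1 | (0 < d)%N && all (mem ps) (primes d)) (d%:R `^ (- e) : R) + c * S.
  by rewrite mulrBr mulr1 lerBlDr [S * c]mulrC.
rewrite {1}/S (bigID (fun d : 'I_X.+1 => p %| d)%N) /= addrC; apply: lerD.
  rewrite [leRHS](bigID (fun d : 'I_X.+1 => p %| d)%N) /= ler_wpDl//.
    by apply: sumr_ge0 => i _; exact: powR_ge0.
  rewrite le_eqVlt; apply/orP; left; apply/eqP; apply: eq_bigl => d.
  case pd: (p %| d)%N; rewrite ?andbF// !andbT.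
  case d0: (0 < d)%N => //=; apply: eq_in_all => r /=.
  rewrite mem_primes inE => /and3P[_ _ rd]; case: eqVneq rd => //= ->.
  by rewrite pd.
rewrite /S big_distrr /=.
apply: (@ler_sum_inj _ _ _ _ (fun d : 'I_X.+1 => inord (d %/ p))).
- move=> d /andP[/andP[d0 /allP ad] pd].
  have lt : (d %/ p < X.+1)%N by rewrite (leq_ltn_trans (leq_div _ _))// ltn_ord.
  rewrite inordK// divn_gt0 ?prime_gt0// dvdn_leq//=.
  apply/allP => r; rewrite mem_primes => /and3P[pr _ rd]; apply: ad.
  by rewrite mem_primes pr d0 -(divnK pd) dvdn_mulr.
- move=> d d' /andP[_ pd] /andP[_ pd'].
  have lt (u : 'I_X.+1) : (u %/ p < X.+1)%N.
    by rewrite (leq_ltn_trans (leq_div _ _))// ltn_ord.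
  move=> /(congr1 (@nat_of_ord _)); rewrite !inordK// => E.
  by apply: val_inj; rewrite /= -(divnK pd) -(divnK pd') E.
- move=> d /andP[_ pd]; rewrite inordK; last first.
    by rewrite (leq_ltn_trans (leq_div _ _))// ltn_ord.
  by rewrite /c -powRM// -natrM mulnC divnK.
- by move=> j _; rewrite mulr_ge0// ?powR_ge0// ltW.
Qed.

(** With t = p^(-e), the bound 1/(1 - t) <= 1/t holds once t <= 1/2, that is p >= 2^(1/e). The fewer
    than [p0] smaller primes cost at most the factor [c] of p = 2 each, whence C = c^p0
    independently of q. The product of the primes of q is at most q. *)
Lemma euler_prod_bound : exists2 C : R, 1 <= C & forall q : nat, (0 < q)%N ->
  \prod_(p <- primes q) (1 - p%:R `^ (- e))^-1 <= C * q%:R `^ e.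
Proof.
have /andP[t0 t1] := powRN_lt1 2 isT.
pose c : R := (1 - 2%:R `^ (- e))^-1.
have c1 : 1 <= c by rewrite invf_ge1 ?subr_gt0//; lra.
pose p0 := (Num.truncn (2%:R `^ e^-1 : R)).+1.
exists (c ^+ p0); first exact: exprn_ege1.
move=> q q0.
have b1 (p : nat) : (1 < p)%N ->
    (1 - p%:R `^ (- e))^-1 <= (if (p < p0)%N then c else 1) * p%:R `^ e.
  move=> p1; have /andP[d0 d1] := powRN_lt1 p p1.
  have pe1 : 1 <= p%:R `^ e :> R.
    by apply: powR_ge1; [rewrite ler1n ltnW | exact: ltW].
  case: ltnP => pp0.
    apply: (@le_trans _ _ c); last by rewrite ler_peMr// (le_trans ler01).
    rewrite lef_pV2 ?posrE ?subr_gt0// lerB//.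
    have pp : 0 < (p%:R : R) by rewrite ltr0n ltnW.
    rewrite !powRN lef_pV2 ?posrE ?powR_gt0//.
    by apply: ge0_ler_powR; rewrite ?nnegrE ?ler0n ?ler_nat// ltW.
  have pe2 : 2 <= p%:R `^ e :> R.
    have {1}-> : 2 = (2 `^ e^-1) `^ e :> R by rewrite -powRrM mulVf ?gt_eqF// powRr1.
    apply: ge0_ler_powR; rewrite ?nnegrE ?powR_ge0 ?ler0n//; first exact: ltW.
    have : (p0%:R : R) <= p%:R by rewrite ler_nat.
    by apply: le_trans; apply/ltW/truncnS_gt.
  rewrite mul1r (le_trans _ pe2)// powRN -[leRHS]invrK lef_pV2 ?posrE ?invr_gt0//.
    suff : (p%:R `^ e)^-1 <= 2^-1 :> R by lra.
    by rewrite lef_pV2 ?posrE// (lt_le_trans _ pe2).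
  by rewrite -powRN subr_gt0.
apply: (@le_trans _ _ (\prod_(p <- primes q) ((if (p < p0)%N then c else 1) * p%:R `^ e))).
  rewrite big_seq [leRHS]big_seq; apply: ler_prod => p.
  rewrite mem_primes => /andP[/prime_gt1 p1 _]; rewrite b1// andbT.
  by have /andP[? ?] := powRN_lt1 p p1; rewrite invr_ge0; lra.
rewrite big_split /=; apply: ler_pM.
- by apply: prodr_ge0 => p _; case: ifP => _; rewrite ?(le_trans ler01).
- by apply: prodr_ge0 => p _; exact: powR_ge0.
- rewrite -big_mkcond big_const_seq iter_mulr_1 ler_weXn2l//.
  rewrite -size_filter -[leqRHS](size_iota 0); apply: uniq_leq_size.
    exact/filter_uniq/primes_uniq.
  by move=> p; rewrite mem_filter mem_iota => /andP[].
- have -> (s : seq nat) : \prod_(p <- s) (p%:R `^ e : R) = (\prod_(p <- s) p)%N%:R `^ e.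
    elim: s => [|p s IH]; first by rewrite !big_nil powR1.
    by rewrite !big_cons IH natrM powRM.
  apply: ge0_ler_powR; rewrite ?nnegrE ?ler0n ?ler_nat//; first exact: ltW.
  rewrite [leqRHS](prod_prime_decomp q0) prime_decompE big_map /=.
  rewrite big_seq [leqRHS]big_seq; apply: leq_prod => p.
  move=> pq; rewrite -[leqLHS]expn1 leq_pexp2l ?logn_gt0//.
  by move: pq; rewrite mem_primes => /andP[/prime_gt0].
Qed.

(** For d <= X one has 1 <= X^e d^(-e), and the sum of d^(-e) over integers composed of primes of q
    is below the Euler product. The constant depends on e only. *)
Lemma rankin : exists2 C : R, 1 <= C & forall q X : nat, (0 < q)%N -> (0 < X)%N ->
  \sum_(d < X.+1 | (0 < d)%N && \pi(q).-nat d) 1 <= C * q%:R `^ e * X%:R `^ e.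
Proof.
have [C C1 HC] := euler_prod_bound; exists C => // q X q0 X0.
have X1 : (1 : R) <= X%:R by rewrite ler1n.
apply: le_trans (ler_wpM2r (powR_ge0 _ _) (HC q q0)).
have := @rankin_seq (primes q) X _ (primes_uniq q).
have -> : all prime (primes q) by apply/allP => p; rewrite mem_primes => /andP[].
move=> /(_ isT) /(ler_wpM2r (powR_ge0 X%:R e)); apply: le_trans.
rewrite mulr_suml; under [leRHS]eq_bigl => d do rewrite -/(_ && _).
rewrite [leRHS](eq_bigl (fun d : 'I_X.+1 => (0 < d)%N && \pi(q).-nat d)); last first.
  by move=> d /=; rewrite /pnat; case: posnP.
apply: ler_sum => d /andP[d0 _].
rewrite powRN mulrC ler_pdivlMr ?powR_gt0 ?ltr0n// mul1r.
apply: ge0_ler_powR; [exact: ltW|exact: ler0n|exact: ler0n|].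
by rewrite ler_nat -ltnS ltn_ord.
Qed.

End Rankin.

(** * The decomposition x = m w *)

(* m consists of the largest primes of x: it divides x, and no prime of the
   cofactor exceeds the least prime of m. *)
Definition top_divisor (x m : nat) : bool :=
  ((m %| x) && all (fun p => p <= pdiv m) (primes (x %/ m)))%N.

Lemma dvdn_log (m n : nat) : (0 < m)%N -> (0 < n)%N ->
  (forall p, prime p -> (logn p m <= logn p n)%N) -> (m %| n)%N.
Proof.
move=> m0 n0 H; apply/(dvdn_partP n m0) => p.
rewrite mem_primes => /and3P[pp _ _].
by rewrite p_part pfactor_dvdn// H.
Qed.

(** Top divisors of x form a chain. If p occurred more often in m than in m', it would divide x/m'
    and so be at most every prime of m'. Primes r < p then do not divide m', while primes r > p
    exceed the least prime of m and have in m their full multiplicity in x. Hence m' | m, against m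
    < m'. *)
Lemma top_divisor_dvd (x m m' : nat) : (0 < x)%N -> (1 < m)%N -> (1 < m')%N ->
  top_divisor x m -> top_divisor x m' -> (m < m')%N -> (m %| m')%N.
Proof.
move=> x0 m1 m'1 /andP[mx /allP tm] /andP[m'x /allP tm'] lt.
have [m0 m'0] : (0 < m)%N /\ (0 < m')%N by lia.
have logx n p : (n %| x)%N -> prime p -> (logn p n < logn p x)%N -> p \in primes (x %/ n).
  move=> nx pp; rewrite mem_primes pp -{1}(divnK nx).
  have n0 : (0 < n)%N by move: nx; case: n => //; rewrite dvd0n => /eqP x0'; rewrite x0' in x0.
  have q0 : (0 < x %/ n)%N by rewrite divn_gt0// dvdn_leq.
  rewrite lognM// q0 /= -{1}[logn p n]add0n ltn_add2r logn_gt0 mem_primes.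
  by move=> /and3P[].
apply: dvdn_log => // p pp; rewrite leqNgt; apply/negP => plt.
have pm : (p %| m)%N.
  by move: (leq_ltn_trans (leq0n _) plt); rewrite logn_gt0 mem_primes => /and3P[].
have pm' : (p <= pdiv m')%N.
  by apply: tm'; apply: logx => //; apply: (leq_trans plt); exact: dvdn_leq_log.
have pdm : (pdiv m <= p)%N by apply: pdiv_min_dvd => //; exact: prime_gt1.
suff /(dvdn_leq m0) : (m' %| m)%N by rewrite leqNgt lt.
apply: dvdn_log => // r pr; case: (ltngtP r p) => [rp|pr'|->]; last exact: ltnW.
  have : ~~ (r %| m')%N.
    by apply/negP => /(pdiv_min_dvd (prime_gt1 pr)); lia.
  by case: (posnP (logn r m')) => [->//|]; rewrite logn_gt0 mem_primes => /and3P[_ _ ->].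
apply: (leq_trans (dvdn_leq_log r x0 m'x)); rewrite leqNgt; apply/negP => /(logx _ _ mx pr)/tm.
lia.
Qed.

(** With m' = n m, the factor n divides x/m, so its least prime is at most that of m. The least
    prime of m' therefore divides n, and removing it leaves a multiple of m. *)
Lemma top_divisor_gap (x m m' : nat) : (0 < x)%N -> (1 < m)%N -> (1 < m')%N ->
  top_divisor x m -> top_divisor x m' -> (m < m')%N -> (m <= m' %/ pdiv m')%N.
Proof.
move=> x0 m1 m'1 tm tm' lt; have /dvdnP[n m'E] := top_divisor_dvd _ _ _ x0 m1 m'1 tm tm' lt.
move: tm tm' => /andP[mx /allP tm] /andP[m'x _].
have n1 : (1 < n)%N.
  by move: lt m'1; rewrite m'E; case: n {m'E} => [|[|n]] //; rewrite mul1n ltnn.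
have [pp pm'] := (pdiv_prime m'1, pdiv_dvd m').
have rm : (pdiv n <= pdiv m)%N.
  have m0 : (0 < m)%N by exact: ltnW.
  apply: tm; rewrite mem_primes (pdiv_prime n1) divn_gt0// (dvdn_leq x0 mx) /=.
  case/dvdnP: m'x => y ->; rewrite m'E mulnA mulnK//.
  by rewrite dvdn_mull// pdiv_dvd.
have pr : (pdiv m' <= pdiv n)%N.
  apply: pdiv_min_dvd; first exact/prime_gt1/pdiv_prime.
  by rewrite m'E dvdn_mulr// pdiv_dvd.
have pn : (pdiv m' %| n)%N.
  have := pm'; rewrite {2}m'E Euclid_dvdM// => /orP[//|pm].
  have := pdiv_min_dvd (prime_gt1 pp) pm => mp.
  have -> : pdiv m' = pdiv n by lia.
  exact: pdiv_dvd.
rewrite leq_divRL ?pdiv_gt0// {2}m'E mulnC leq_pmul2r; last by lia.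
by rewrite dvdn_leq//; lia.
Qed.

Section Decomposition.
Variable R : realType.

(** With primes taken in decreasing order the last one multiplied into m is its least, so M is
    passed exactly at that step. *)
Definition crosses (M : R) (m : nat) : bool :=
  (M < m%:R) && ((m %/ pdiv m)%:R <= M).

Lemma crosses_gt1 M m : 1 <= M -> crosses M m -> (1 < m)%N.
Proof. by move=> M1 /andP[Mm _]; rewrite -(ltr1n R) (le_lt_trans M1). Qed.

Lemma crosses_le M m (B : R) : crosses M m -> (pdiv m)%:R <= B -> 0 <= M -> m%:R <= M * B.
Proof.
move=> /andP[_ mM] pB M0; rewrite -{1}(divnK (pdiv_dvd m)) natrM.
by apply: ler_pM.
Qed.

Lemma top_divisor_crosses_uniq (M : R) (x m m' : nat) : (0 < x)%N -> 1 <= M ->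
  top_divisor x m -> top_divisor x m' -> crosses M m -> crosses M m' -> m = m'.
Proof.
have gap n n' : (0 < x)%N -> 1 <= M -> top_divisor x n -> top_divisor x n' -> crosses M n ->
    crosses M n' -> (n < n')%N -> False.
  move=> x0 M1 tn tn' bn bn' lt.
  have := top_divisor_gap _ _ _ x0 (crosses_gt1 _ _ M1 bn) (crosses_gt1 _ _ M1 bn') tn tn' lt.
  move: bn bn' => /andP[Mn _] /andP[_ n'M]; rewrite -(ler_nat R) => nn'.
  by have := lt_le_trans Mn (le_trans nn' n'M); rewrite ltxx.
move=> x0 M1 tm tm' bm bm'; case: (ltngtP m m') => // lt; exfalso.
- exact: (gap m m').
- exact: (gap m' m).
Qed.

(** Take the least top divisor m > M; x itself is a candidate. Without its least prime m is still a
    top divisor, since the prime moved to the cofactor is at most all primes left in m, so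
    minimality puts it at or below M. *)
Lemma top_divisor_crosses_ex (M : R) (x : nat) : 1 <= M -> M < x%:R ->
  exists m, top_divisor x m && crosses M m.
Proof.
move=> M1 Mx; have x1 : (1 < x)%N by rewrite -(ltr1n R) (le_lt_trans M1).
have ex : exists m, top_divisor x m && (M < m%:R).
  by exists x; rewrite Mx andbT /top_divisor dvdnn divnn ltnW.
exists (ex_minn ex); case: ex_minnP => m /andP[tm Mm] min; rewrite tm /crosses Mm /=.
have m1 : (1 < m)%N by rewrite -(ltr1n R) (le_lt_trans M1).
have pp := pdiv_prime m1.
rewrite leNgt; apply/negP => lt.
suff : (m <= m %/ pdiv m)%N.
  by rewrite leqNgt ltn_Pdiv ?prime_gt1 // ltnW.
apply: min; rewrite lt andbT; move: tm => /andP[mx /allP tm]; apply/andP; split.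
  by apply: dvdn_trans mx; exact: dvdn_div (pdiv_dvd m).
have -> : (x %/ (m %/ pdiv m) = (x %/ m) * pdiv m)%N.
  have a0 : (0 < m %/ pdiv m)%N by rewrite divn_gt0 ?pdiv_gt0// pdiv_leq// ltnW.
  rewrite -[RHS](mulKn _ a0); congr (_ %/ _)%N.
  by rewrite mulnCA divnK ?pdiv_dvd// divnK.
have le q : prime q -> (q %| m %/ pdiv m)%N -> (pdiv m <= q)%N.
  move=> pq qm; apply: pdiv_min_dvd; first exact: prime_gt1.
  by rewrite -(divnK (pdiv_dvd m)) dvdn_mulr.
have m1' : (1 < m %/ pdiv m)%N by rewrite -(ltr1n R) (le_lt_trans M1).
have pl : (pdiv m <= pdiv (m %/ pdiv m))%N by apply: le; [exact: pdiv_prime|exact: pdiv_dvd].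
apply/allP => r; rewrite mem_primes => /and3P[pr xm0 rd].
apply: leq_trans pl; move: rd; rewrite Euclid_dvdM// => /orP[rx|/dvdn_leq->//].
  apply: tm; rewrite mem_primes pr rx andbT/=.
  by move: xm0; rewrite muln_gt0 => /andP[].
Qed.

Lemma smoothbP (P Rr : R) n : reflect
  [/\ (0 < n)%N, n%:R <= P & forall p, p \in primes n -> p%:R <= Rr] (smoothb P Rr n).
Proof.
by apply: (iffP and3P) => -[n0 nP H]; split => //; [exact/allP|apply/allP].
Qed.

(** The primes of w being at most [pdiv m] says precisely that m is a top divisor of m w, so x <->
    (m, w) is a bijection for x > M. An arbitrary [phi] lets the cosine and sine sums share it. *)
Lemma vaughan_decomp (phi : nat -> R) (P M Rr : R) : 1 <= M -> M <= P ->
  \sum_(n < (Num.truncn P).+1 | smoothb P Rr n) phi n =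
  \sum_(n < (Num.truncn M).+1 | smoothb M Rr n) phi n +
  \sum_(m < (Num.truncn P).+1 | smoothb P Rr m && crosses M m)
    \sum_(w < (Num.truncn (P / m%:R)).+1 | smoothb (P / m%:R) (pdiv m)%:R w)
       phi (m * w)%N.
Proof.
move=> M1 MP; have P0 : 0 <= P by lra.
set N := (Num.truncn P).+1.
have inN (n : nat) : n%:R <= P -> (n < N)%N by move=> nP; rewrite ltnS truncn_ge_nat.
rewrite (bigID (fun n : 'I_N => n%:R <= M)) /=; congr (_ + _).
  rewrite (big_ord_widen_cond N (smoothb M Rr) phi); last by rewrite ltnS le_truncn.
  apply: eq_bigl => n; rewrite ltnS truncn_ge_nat; last by lra.
  rewrite /smoothb; case nM : (n%:R <= M); last by rewrite !andbF.
  by rewrite !andbT (le_trans nM).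
rewrite [RHS](eq_bigr (fun m : 'I_N => \sum_(w < N | smoothb (P / m%:R) (pdiv m)%:R w && (w < (Num.truncn (P / m%:R)).+1)%N) phi (m * w)%N)); last first.
  move=> m /andP[/smoothbP[m0 mP _] _].
  rewrite (big_ord_widen_cond N (smoothb (P / m%:R) (pdiv m)%:R) (fun w => phi (m * w)%N))//.
  by rewrite ltnS le_truncn// ler_pdivrMr ?ltr0n// ler_peMr// ler1n.
rewrite pair_big_dep /=.
(* The default [ord0] is returned only where no such m exists, which [cP] excludes for M < n <=
   P. *)
pose c (n : nat) : 'I_N := odflt ord0 [pick m : 'I_N | top_divisor n m && crosses M m].
have cP (n : nat) : n%:R <= P -> M < n%:R -> top_divisor n (c n) && crosses M (c n).
  move=> nP Mn; have [m /andP[tm bm]] := top_divisor_crosses_ex _ _ M1 Mn.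
  have n0 : (0 < n)%N by rewrite -(ltr0n R); lra.
  have mN : (m < N)%N.
    by apply: leq_ltn_trans (inN n nP); rewrite dvdn_leq//; case/andP: tm.
  rewrite /c; case: pickP => [//|/(_ (Ordinal mN))]; by rewrite /= tm bm.
rewrite (reindex_onto (fun x : 'I_N * 'I_N => inord (x.1 * x.2) : 'I_N)
   (fun n : 'I_N => (c n, inord (n %/ c n) : 'I_N))); last first.
  move=> n /andP[/smoothbP[n0 nP _]]; rewrite -ltNge => Mn.
  have /andP[/andP[cn _] _] := cP n nP Mn.
  apply: val_inj => /=; rewrite (@inordK _ (n %/ c n)); last first.
    by rewrite (leq_ltn_trans (leq_div _ _))// ltn_ord.
  by rewrite mulnC divnK// inordK.
have key (m w : 'I_N) : (0 < m)%N -> (0 < w)%N -> (m * w)%:R <= P ->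
    (inord (m * w) : 'I_N) = (m * w)%N :> nat.
  by move=> m0 w0 mw; rewrite inordK// inN.
have fwd (m w : 'I_N) : smoothb P Rr m && crosses M m &&
    (smoothb (P / m%:R) (pdiv m)%:R w && (w < (Num.truncn (P / m%:R)).+1)%N) ->
    [/\ (inord (m * w) : 'I_N) = (m * w)%N :> nat, smoothb P Rr (m * w), M < (m * w)%:R, c (m * w)%N = m & (0 < m)%N].
  move=> /andP[/andP[/smoothbP[m0 mP pm] bm] /andP[/smoothbP[w0 wP pw] _]].
  have mwP : (m * w)%:R <= P by move: wP; rewrite ler_pdivlMr ?ltr0n// -natrM mulnC.
  have m1 := crosses_gt1 _ _ M1 bm.
  have Mmw : M < (m * w)%:R.
    by case/andP: bm => Mm _; apply: (lt_le_trans Mm); rewrite ler_nat leq_pmulr.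
  split=> //; first exact: key.
    apply/smoothbP; split=> //; first by rewrite muln_gt0 m0.
    move=> p; rewrite primesM// => /orP[/pm//|/pw pw'].
    apply: (le_trans pw'); apply: pm.
    by rewrite mem_primes pdiv_prime// m0 pdiv_dvd.
  have /andP[tc bc] := cP _ mwP Mmw.
  apply/val_inj/(top_divisor_crosses_uniq M (m * w)) => //=; first by rewrite muln_gt0 m0.
  rewrite /top_divisor dvdn_mulr//= mulKn//; apply/allP => p /pw; by rewrite ler_nat.
rewrite [RHS](eq_bigr (fun x : 'I_N * 'I_N => phi (inord (x.1 * x.2) : 'I_N))); last first.
  by move=> [m w] /= H; have [-> _ _ _ _] := fwd m w H.
apply: eq_bigl => -[m w] /=.
  apply/idP/idP => [/andP[/andP[sm nM] /eqP [E1 E2]]|H].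
    move: sm nM E1 E2; set n : nat := inord (m * w); rewrite -ltNge => /smoothbP[n0 nP pn] Mn E1 E2.
    have /andP[/andP[cn tc] bc] := cP _ nP Mn.
    rewrite E1 in cn tc bc E2.
    have E : (n %/ m)%N = w by rewrite -E2 inordK// (leq_ltn_trans (leq_div _ _))// ltn_ord.
    have nE : n = (m * w)%N by rewrite mulnC -E divnK.
    have [m0 w0] : (0 < m)%N /\ (0 < w)%N by move: n0; rewrite nE muln_gt0 => /andP.
    have wP : w%:R <= P / m%:R by rewrite ler_pdivlMr ?ltr0n// -natrM mulnC -nE.
    rewrite bc andbT; apply/andP; split; last (apply/andP; split).
    - apply/smoothbP; split=> //.
        by apply: le_trans nP; rewrite nE ler_nat leq_pmulr.
      by move=> p pm; apply: pn; rewrite nE primesM// pm.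
    - apply/smoothbP; split=> // p pw; rewrite ler_nat; apply: (allP tc).
      by rewrite E.
    - by rewrite ltnS truncn_ge_nat// (le_trans _ wP).
  have [E s Mn cE m0] := fwd m w H.
  rewrite E s -ltNge Mn /= cE; apply/eqP; congr pair; apply: val_inj => /=.
  by rewrite mulKn// inordK.
Qed.

End Decomposition.

(** * Exponential sums *)

Section ExpSum.
Variable R : realType.
Implicit Types (a b c d P M Rr alpha x : R) (k : nat).

Definition norm2 a b : R := Num.sqrt (a ^+ 2 + b ^+ 2).

Lemma norm2_ge0 a b : 0 <= norm2 a b.
Proof. exact: sqrtr_ge0. Qed.

Lemma norm2D a b c d : norm2 (a + c) (b + d) <= norm2 a b + norm2 c d.
Proof.
have sq u v : norm2 u v ^+ 2 = u ^+ 2 + v ^+ 2 by rewrite sqr_sqrtr// addr_ge0 ?sqr_ge0.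
have n1 := norm2_ge0 a b; have n2 := norm2_ge0 c d.
rewrite -[leRHS]ger0_norm ?addr_ge0// -sqrtr_sqr ler_sqrt ?sqr_ge0//.
have E1 := sq a b; have E2 := sq c d.
have cs : a * c + b * d <= norm2 a b * norm2 c d.
  rewrite (le_trans (ler_norm _))// -(@ger0_norm _ (norm2 a b * norm2 c d)) ?mulr_ge0//.
  rewrite -ler_sqr ?nnegrE// !real_normK ?num_real// exprMn E1 E2.
  (* Lagrange's identity reduces Cauchy-Schwarz to the positivity of this square. *)
  by have := sqr_ge0 (a * d - b * c); nra.
nra.
Qed.

Lemma norm2_sum (I : Type) (r : seq I) (p : pred I) (F G : I -> R) :
  norm2 (\sum_(i <- r | p i) F i) (\sum_(i <- r | p i) G i) <=
  \sum_(i <- r | p i) norm2 (F i) (G i).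
Proof.
elim: r => [|i r IH]; first by rewrite !big_nil /norm2 expr0n addr0 sqrtr0.
rewrite !big_cons; case: ifP => // _.
by apply: (le_trans (norm2D _ _ _ _)); rewrite lerD2l.
Qed.

Lemma fabs_ge0 k P Rr alpha : 0 <= fabs k P Rr alpha.
Proof. exact: sqrtr_ge0. Qed.

Lemma fabs_le k P Rr alpha : 0 <= P -> fabs k P Rr alpha <= P.
Proof.
move=> P0; apply: (le_trans (norm2_sum _ _ _ _ _)).
apply: (@le_trans _ _ (\sum_(n < (Num.truncn P).+1 | smoothb P Rr n) 1)).
  by apply: ler_sum => n _; rewrite /norm2 cos2Dsin2 sqrtr1.
apply: (@le_trans _ _ (\sum_(n < (Num.truncn P).+1 | (0 < n)%N) 1)).
  rewrite big_mkcond [leRHS]big_mkcond; apply: ler_sum => n _.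
  by case: (boolP (smoothb P Rr n)) => [/and3P[->]|_]//; case: ifP.
rewrite big_mkcond big_ord_recl /= add0r sumr_const card_ord.
by rewrite truncn_le.
Qed.

Lemma fabs_periodic k P Rr alpha : fabs k P Rr (alpha + 1) = fabs k P Rr alpha.
Proof.
have E (n : nat) : 2 * pi * ((alpha + 1) * n%:R ^+ k) =
    2 * pi * (alpha * n%:R ^+ k) + (pi *+ 2) *+ (n ^ k) :> R.
  by rewrite -natrX -[(pi *+ 2) *+ _]mulr_natr -[pi *+ 2]mulr_natl; ring.
rewrite /fabs; congr (Num.sqrt (_ ^+ 2 + _ ^+ 2)).
- by apply: eq_bigr => n _; rewrite E (periodicn (@cosD2pi R)).
- by apply: eq_bigr => n _; rewrite E (periodicn (@sinD2pi R)).
Qed.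

Lemma continuous_trig k (n : nat) :
  continuous (fun x => cos (2 * pi * (x * n%:R ^+ k)) : R) /\
  continuous (fun x => sin (2 * pi * (x * n%:R ^+ k)) : R).
Proof.
have cl : continuous (fun x => 2 * pi * (x * n%:R ^+ k) : R).
  move=> x; apply: cvgM; first exact: cvg_cst.
  by apply: cvgM; [exact: cvg_id|exact: cvg_cst].
split=> x; exact: (continuous_comp (cl x) (@continuous_cos R _)) ||
  exact: (continuous_comp (cl x) (@continuous_sin R _)).
Qed.

Lemma continuous_fabs k P Rr : continuous (fabs k P Rr).
Proof.
move=> x; rewrite /fabs; apply: continuous_comp; last exact: sqrt_continuous.
have cRe : {for x, continuous (fRe k P Rr)}.
  by apply: (@continuous_sumf R) => n _; have [] := continuous_trig k n.
have cIm : {for x, continuous (fIm k P Rr)}.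
  by apply: (@continuous_sumf R) => n _; have [] := continuous_trig k n.
by apply: cvgD; apply: cvgM.
Qed.

(** Where f is positive, the power is differentiable. At a zero of f continuity comes from f^s <= f
    as soon as f <= 1, because s >= 1. *)
Lemma continuous_powR_ge0 (s : R) (f : R -> R) : 1 <= s -> continuous f ->
  (forall x, 0 <= f x) -> continuous (fun x => f x `^ s).
Proof.
move=> s1 cf f0 x; have := f0 x; rewrite le_eqVlt => /predU1P[fx0|fx0]; last first.
  apply: (@continuous_comp _ _ _ f (fun y => y `^ s)); first exact: cf.
  apply: differentiable_continuous; apply/derivable1_diffP.
  by apply: derivable_powR; rewrite in_itv/= fx0.
rewrite /continuous_at -fx0 powR0; last by lra.
apply/cvgr0Pnorm_le => e e0; have := cf x; rewrite /continuous_at -fx0.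
move=> /cvgr0Pnorm_le H.
have m0 : 0 < Num.min 1 e by rewrite lt_min ltr01 e0.
near=> y; have : `|f y| <= Num.min 1 e by near: y; exact: H.
rewrite ger0_norm// le_min => /andP[fy1 fye].
rewrite ger0_norm ?powR_ge0//; apply: le_trans fye.
have := f0 y; rewrite le_eqVlt => /predU1P[<-|fy0]; first by rewrite powR0//; lra.
by apply: ge1r_powR => //; rewrite fy0.
Unshelve. all: by end_near. Qed.

Lemma powR_sum2 (s a b : R) : 0 <= s -> 0 <= a -> 0 <= b ->
  (a + b) `^ s <= 2 `^ s * (a `^ s + b `^ s).
Proof.
wlog ab : a b / a <= b => [W s0 a0 b0|s0 a0 b0].
  have [ab|/ltW ba] := leP a b; first exact: W.
  by rewrite addrC [_ `^ s + _]addrC; exact: W.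
apply: (@le_trans _ _ ((2 * b) `^ s)).
  by apply: ge0_ler_powR; rewrite ?nnegrE//; lra.
by rewrite powRM// ler_wpM2l ?powR_ge0// lerDr powR_ge0.
Qed.

(* Up to the factor 2^s, Hölder with weights: the terms below half of the
   weighted mean contribute at most half of the sum. *)
Lemma weighted_power_mean (I : finType) (p : pred I) (s T : R) (y v : I -> R) :
  1 <= s -> (forall i, p i -> 0 <= y i) -> (forall i, p i -> 0 < v i) ->
  0 < T -> \sum_(i | p i) (v i)^-1 <= T ->
  (\sum_(i | p i) y i) `^ s <= 2 `^ s * T `^ (s - 1) *
    \sum_(i | p i) (v i) `^ (s - 1) * y i `^ s.
Proof.
move=> s1 y0 v0 T0 vT; set Y := \sum_(i | p i) y i; set S := \sum_(i | p i) _ `^ _ * _.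
have Y0 : 0 <= Y by exact: sumr_ge0.
have S0 : 0 <= S by apply: sumr_ge0 => i _; rewrite mulr_ge0 ?powR_ge0.
move: Y0; rewrite le_eqVlt => /predU1P[<-|Y0].
  by rewrite powR0; [rewrite !mulr_ge0 ?powR_ge0|lra].
(* Half of the weighted mean: the terms with y_i <= l / v_i add up to at most l T = Y / 2. *)
pose l := Y / (2 * T).
have l0 : 0 < l by rewrite divr_gt0 ?mulr_gt0.
have s0 : 0 < s by lra.
have Yh : 0 <= Y / 2 by rewrite divr_ge0// ltW.
(* A small term is bounded by l / v_i; for a large one l < v_i y_i, so l^(s-1) is replaced by (v_i
   y_i)^(s-1). *)
have pt i : p i -> y i * l `^ (s - 1) <= l `^ s * (v i)^-1 + (v i) `^ (s - 1) * y i `^ s.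
  move=> pi; have vi := v0 i pi; have yi := y0 i pi.
  have [yl|ly] := leP (y i) (l / v i).
    apply: (@le_trans _ _ (l `^ s * (v i)^-1)); last first.
      by rewrite lerDl mulr_ge0 ?powR_ge0.
    rewrite -[in leRHS](@mulr_powRB1 _ l s (ltW l0) s0).
    by rewrite mulrAC ler_wpM2r// powR_ge0.
  apply: (@le_trans _ _ (v i `^ (s - 1) * y i `^ s)); last first.
    by rewrite lerDr mulr_ge0 ?powR_ge0// invr_ge0 ltW.
  rewrite -(@mulr_powRB1 _ (y i) s)// mulrCA ler_wpM2l//.
  rewrite -(powRM _ (ltW vi) yi); apply: ge0_ler_powR; rewrite ?nnegrE.
  - lra.
  - exact: ltW.
  - exact: mulr_ge0 (ltW vi) yi.
  - by rewrite mulrC -ler_pdivrMr// ltW.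
have : Y * l `^ (s - 1) <= l `^ s * T + S.
  rewrite /Y mulr_suml (le_trans (ler_sum _ pt))// big_split/= lerD// -mulr_sumr.
  by rewrite ler_wpM2l ?powR_ge0.
rewrite -[l `^ s](@mulr_powRB1 _ l s (ltW l0) s0).
have -> : l * l `^ (s - 1) * T = Y / 2 * l `^ (s - 1) by rewrite /l; field; rewrite gt_eqF.
move=> H; have {}H : Y / 2 * l `^ (s - 1) <= S by lra.
have lE : l `^ (s - 1) * T `^ (s - 1) = (Y / 2) `^ (s - 1).
  rewrite -(powRM _ (ltW l0) (ltW T0)); congr (_ `^ _); rewrite /l; field.
  by rewrite gt_eqF.
have YE : Y `^ s = 2 `^ s * (Y / 2) `^ s.
  by rewrite -powRM//; congr (_ `^ _); field.
rewrite YE -mulrA ler_wpM2l ?powR_ge0// -(@mulr_powRB1 _ (Y / 2) s)//.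
by rewrite -lE mulrA mulrC ler_wpM2l ?powR_ge0.
Qed.

End ExpSum.

(** * The recursion *)

Section Recursion.
Variable R : realType.
Implicit Types (P M Rr alpha x Q T s : R) (k : nat).

Lemma fabs_decomp k P M Rr alpha : 1 <= M -> M <= P ->
  fabs k P Rr alpha <= M +
  \sum_(m < (Num.truncn P).+1 | smoothb P Rr m && crosses _ M m)
    fabs k (P / m%:R) (pdiv m)%:R ((m ^ k)%:R * alpha).
Proof.
move=> M1 MP; rewrite {1}/fabs /fRe /fIm.
rewrite (vaughan_decomp _ (fun n => cos (2 * pi * (alpha * n%:R ^+ k))) P M)//.
rewrite (vaughan_decomp _ (fun n => sin (2 * pi * (alpha * n%:R ^+ k))) P M)//.
apply: (le_trans (norm2D _ _ _ _ _)); apply: lerD.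
  by apply: (@fabs_le _ k M Rr alpha); lra.
apply: (le_trans (norm2_sum _ _ _ _ _ _)); apply: ler_sum => m _.
rewrite le_eqVlt; apply/orP; left; apply/eqP.
have E (w : nat) : alpha * (m * w)%:R ^+ k = (m ^ k)%:R * alpha * w%:R ^+ k.
  by rewrite natrM exprMn natrX; ring.
by congr (Num.sqrt (_ ^+ 2 + _ ^+ 2)); apply: eq_bigr => w _; rewrite E.
Qed.

Lemma smooth_crosses_le P M Rr m : 1 <= M -> smoothb P Rr m -> crosses R M m ->
  [/\ (1 < m)%N, m%:R <= M * Rr, (pdiv m)%:R <= Rr & m%:R <= P].
Proof.
move=> M1 /(smoothbP R)[m0 mP pm] bm; have m1 := crosses_gt1 _ _ _ M1 bm.
have pR : (pdiv m)%:R <= Rr by apply: pm; rewrite mem_primes pdiv_prime// m0 pdiv_dvd.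
by split=> //; apply: crosses_le bm pR _; lra.
Qed.

Lemma sum_smooth_crosses_le P M Rr (F : nat -> R) : 1 <= M -> 1 <= Rr ->
  (forall m, 0 <= F m) ->
  \sum_(m < (Num.truncn P).+1 | smoothb P Rr m && crosses _ M m) F m <=
  \sum_(m < (Num.truncn (M * Rr)).+1 | (0 < m)%N) F m.
Proof.
move=> M1 R1 F0; set X := Num.truncn (M * Rr).
have lt (m : nat) : smoothb P Rr m && crosses R M m -> (m < X.+1)%N.
  move=> /andP[sm bm]; have [_ mM _ _] := smooth_crosses_le _ _ _ _ M1 sm bm.
  by rewrite ltnS truncn_ge_nat//; nra.
apply: (@ler_sum_inj _ _ _ _ _ (fun m : 'I__ => inord m : 'I_X.+1)) => //.
- by move=> m H; rewrite inordK ?lt//; case/andP: H => /and3P[].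
- move=> m m' H H' /(congr1 (@nat_of_ord _)); rewrite !inordK ?lt// => E.
  exact: val_inj.
- by move=> m H; rewrite inordK ?lt.
Qed.

(* The q-part of m serves as weight, since it dominates gcd(q, m^k)^(1/k). *)
Lemma fabs_pow_bound k s P M Rr alpha (q : nat) (Psi : R) :
  1 <= s -> 1 <= M -> M <= P -> 1 <= Rr -> 0 < Psi ->
  \sum_(d < (Num.truncn (M * Rr)).+1 | (0 < d)%N && \pi(q).-nat d) 1 <= Psi ->
  fabs k P Rr alpha `^ s <= 2 `^ s * M `^ s + 4 `^ s * Psi `^ (s - 1) *
  \sum_(m < (Num.truncn P).+1 | smoothb P Rr m && crosses _ M m)
    (M * Rr / (m`_(\pi(q)))%N%:R) `^ (s - 1) *
    fabs k (P / m%:R) (pdiv m)%:R ((m ^ k)%:R * alpha) `^ s.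
Proof.
move=> s1 M1 MP R1 Psi0 cnt.
have s0 : 0 <= s by lra.
have M'1 : 1 <= M * Rr by nra.
apply: (@le_trans _ _ ((M + \sum_(m < (Num.truncn P).+1 | smoothb P Rr m && crosses _ M m)
    fabs k (P / m%:R) (pdiv m)%:R ((m ^ k)%:R * alpha)) `^ s)).
  apply: ge0_ler_powR; rewrite ?nnegrE ?fabs_ge0//; last exact: fabs_decomp.
  by apply: addr_ge0; [lra|apply: sumr_ge0 => m _; exact: fabs_ge0].
apply: (le_trans (powR_sum2 _ _ _ _ _ _ _)) => //; first lra.
  by apply: sumr_ge0 => m _; exact: fabs_ge0.
rewrite mulrDr lerD2l.
have -> : 4 `^ s = 2 `^ s * 2 `^ s :> R by rewrite -powRM//; congr (_ `^ _); lra.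
rewrite -2!mulrA ler_wpM2l ?powR_ge0// mulrA.
(* The weights are M Rr / d with d the q-part of m. Their inverses sum to at most Psi, by
   [sum_partn_le] with X = M Rr rounded down. *)
apply: weighted_power_mean => //.
- by move=> m _; exact: fabs_ge0.
- move=> m _; rewrite divr_gt0 ?ltr0n ?part_gt0//; lra.
under eq_bigr do rewrite invf_div.
rewrite -mulr_suml ler_pdivrMr; last by lra.
set X := Num.truncn (M * Rr).
have XM : X%:R <= M * Rr by rewrite truncn_le; lra.
apply: (le_trans (sum_smooth_crosses_le P M Rr (fun m => (m`_(\pi(q)))%N%:R) M1 R1 (fun=> ler0n _ _))).
apply: (le_trans (sum_partn_le _ _ _)).
by rewrite mulrC; apply: ler_pM => //; apply: sumr_ge0.
Qed.

Definition fabs_pow k s P Rr : R -> R := fun alpha => fabs k P Rr alpha `^ s.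

Lemma fabs_pow_ge0 k s P Rr x : 0 <= fabs_pow k s P Rr x.
Proof. exact: powR_ge0. Qed.

Lemma fabs_pow_cont k s P Rr : 1 <= s -> continuous (fabs_pow k s P Rr).
Proof.
move=> s1; apply: continuous_powR_ge0 => //; first exact: continuous_fabs.
exact: fabs_ge0.
Qed.

Lemma fabs_pow_per k s P Rr x : fabs_pow k s P Rr (x + 1) = fabs_pow k s P Rr x.
Proof. by rewrite /fabs_pow fabs_periodic. Qed.

(** gcd(q, m^k) is coprime to the part of m^k free of the primes of q, hence divides the other
    part. *)
Lemma gcd_part_le (q m k : nat) : (0 < q)%N -> (0 < m)%N ->
  (gcdn q (m ^ k) <= m`_(\pi(q)) ^ k)%N.
Proof.
move=> q0 m0; apply: dvdn_leq; first by rewrite expn_gt0 part_gt0.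
rewrite -(@Gauss_dvdr _ (m`_(\pi(q)^') ^ k)%N).
  by rewrite -expnMn mulnC partnC// dvdn_gcdr.
apply: coprimeXr; apply: (coprime_dvdl (dvdn_gcdl _ _)).
by apply: (@pnat_coprime (\pi(q))%N); [exact: pnat_pi|exact: part_pnat].
Qed.

Lemma weight_le (M' s : R) (q m k : nat) : 0 <= M' -> 1 <= s -> (0 < k)%N ->
  (0 < q)%N -> (0 < m)%N ->
  (M' / (m`_(\pi(q)))%N%:R) `^ (s - 1) <=
  M' `^ (s - 1) * (gcdn q (m ^ k))%:R `^ (- ((s - 1) / k%:R)).
Proof.
move=> M'0 s1 k0 q0 m0; set g := gcdn q _; set d := (m`_(\pi(q)))%N.
have g0 : (0 : R) < g%:R by rewrite ltr0n gcdn_gt0 q0.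
have d0 : (0 : R) < d%:R by rewrite ltr0n part_gt0.
have kR : (0 : R) < k%:R by rewrite ltr0n.
have gd : g%:R `^ (k%:R^-1) <= d%:R :> R.
  have -> : d%:R = (d%:R `^ k%:R) `^ k%:R^-1 :> R.
    by rewrite -powRrM divff ?gt_eqF// powRr1 ?ler0n.
  apply: ge0_ler_powR; rewrite ?nnegrE ?invr_ge0 ?ler0n ?powR_ge0//.
  by rewrite powR_mulrn ?ler0n// -natrX ler_nat; exact: gcd_part_le.
rewrite powRM ?invr_ge0 ?ler0n// ler_wpM2l ?powR_ge0//.
have -> : - ((s - 1) / k%:R) = (- k%:R^-1) * (s - 1) by ring.
rewrite powRrM; apply: ge0_ler_powR; rewrite ?nnegrE ?invr_ge0 ?powR_ge0 ?ler0n//; first lra.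
by rewrite powRN lef_pV2// posrE powR_gt0.
Qed.

(** The weights depend on q, so the power bound is integrated over the arcs of each q separately.
    Then the q are grouped by g = gcd(q, m^k): [arcsum_scale] yields g / m^k and the weight
    g^(-(s-1)/k). The first term is the bound for x <= M times the total length of the arcs, at most
    2 Q^2 / P^k. *)
Lemma arcsum_recursion k s P M Rr Q (Psi : R) : (0 < k)%N ->
  1 <= s -> 1 <= M -> M <= P -> 1 <= Rr -> 1 <= Q -> 0 < Psi ->
  (forall q : nat, (0 < q)%N -> q%:R <= Q ->
  \sum_(d < (Num.truncn (M * Rr)).+1 | (0 < d)%N && \pi(q).-nat d) 1 <= Psi) ->
  arcsum R (fabs_pow k s P Rr) Q (P ^+ k) <=
  2 `^ s * M `^ s * (2 * Q ^+ 2 / P ^+ k) + 4 `^ s * Psi `^ (s - 1) *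
  \sum_(m < (Num.truncn P).+1 | smoothb P Rr m && crosses _ M m)
    (M * Rr) `^ (s - 1) / (m ^ k)%:R *
    \sum_(g < (Num.truncn Q).+1 | (0 < g)%N && (g %| m ^ k)%N)
      g%:R `^ (1 - (s - 1) / k%:R) *
      arcsum R (fabs_pow k s (P / m%:R) (pdiv m)%:R) (Q / g%:R) ((P / m%:R) ^+ k).
Proof.
move=> k0 s1 M1 MP R1 Q1 Psi0 cnt.
have P0 : 0 < P by lra.
have Q0 : 0 < Q by lra.
have T0 : 0 < P ^+ k by rewrite exprn_gt0.
set T := P ^+ k in T0 *; set N := (Num.truncn P).+1; set n := (Num.truncn Q).+1.
set c := 4 `^ s * _; have c0 : 0 <= c by rewrite mulr_ge0 ?powR_ge0.
pose hm (m : nat) : R -> R := fabs_pow k s (P / m%:R) (pdiv m)%:R.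
have hmc m : continuous (fun x => hm m ((m ^ k)%:R * x)).
  have := continuous_affine _ (hm m) (m ^ k)%:R 0 (fabs_pow_cont _ _ _ _ s1).
  by under eq_fun do rewrite addr0.
pose w (q m : nat) : R := (M * Rr / (m`_(\pi(q)))%N%:R) `^ (s - 1).
have step (q : 'I_n) : (0 < q)%N ->
   arcq R (fabs_pow k s P Rr) Q T q <= 2 `^ s * M `^ s * (2 * Q / T) +
   c * \sum_(m < N | smoothb P Rr m && crosses _ M m) w q m *
      arcq R (fun x => hm m ((m ^ k)%:R * x)) Q T q.
  move=> q0; have q0' : (0 : R) < q%:R by rewrite ltr0n.
  have qQ : q%:R <= Q by rewrite -truncn_ge_nat; [rewrite -ltnS ltn_ord|exact: ltW].
  have d0 : 0 < Q / (q%:R * T) by rewrite divr_gt0// mulr_gt0.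
  rewrite /arcq.
  under [X in _ <= _ + _ * X]eq_bigr do rewrite mulr_sumr.
  rewrite exchange_big /= mulr_sumr.
  apply: (@le_trans _ _ (\sum_(a < q | coprime a q) (2 `^ s * M `^ s * (2 * (Q / (q%:R * T))) +
     c * \sum_(m < N | smoothb P Rr m && crosses _ M m) w q m *
       Int R (fun x => hm m ((m ^ k)%:R * x)) (a%:R / q%:R - Q / (q%:R * T)) (a%:R / q%:R + Q / (q%:R * T))))).
    apply: ler_sum => a _; set u := _ - _; set v := _ + _.
    have uv : u <= v by rewrite /u /v; lra.
    have -> : 2 * (Q / (q%:R * T)) = v - u by rewrite /u /v; lra.
    rewrite -Int_cst//.
    under [X in _ <= _ + _ * X]eq_bigr do rewrite -IntZ//.
    have wc (m : 'I_N) : continuous (fun x => w q m * hm m ((m ^ k)%:R * x)).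
      by move=> x; apply: cvgM; [exact: cvg_cst|exact: hmc].
    rewrite -Int_sum//.
    have sc := continuous_sumf _ _ (index_enum 'I_N) (fun m : 'I_N => smoothb P Rr m && crosses _ M m) _ (fun m _ => wc m).
    have csc : continuous (fun x => c * \sum_(m < N | smoothb P Rr m && crosses _ M m) w q m * hm m ((m ^ k)%:R * x)).
      by move=> x; apply: cvgM; [exact: cvg_cst|exact: sc].
    rewrite -IntZ// -IntD//; try by move=> x; exact: cvg_cst.
    apply: le_Int; first exact: fabs_pow_cont.
      by move=> x; apply: cvgD; [exact: cvg_cst|exact: csc].
    by move=> x _; apply: fabs_pow_bound => //; exact: cnt.
  rewrite big_split /= lerD2r sumr_const -[_ *+ #|_|]mulr_natl.
  apply: (@le_trans _ _ (q%:R * (2 `^ s * M `^ s * (2 * (Q / (q%:R * T)))))).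
    apply: ler_wpM2r; last rewrite ler_nat.
      by apply: mulr_ge0; [rewrite mulr_ge0 ?powR_ge0|apply: mulr_ge0 => //; exact: ltW].
    by rewrite (leq_trans (max_card _))// card_ord.
  rewrite le_eqVlt; apply/orP; left; apply/eqP; field.
  by rewrite !gt_eqF.
rewrite {1}/arcsum -/n.
apply: (@le_trans _ _ (\sum_(q < n | (0 < q)%N) (2 `^ s * M `^ s * (2 * Q / T) +
   c * \sum_(m < N | smoothb P Rr m && crosses _ M m) w q m *
      arcq R (fun x => hm m ((m ^ k)%:R * x)) Q T q))).
  by apply: ler_sum => q q0; exact: step.
rewrite big_split /=; apply: lerD.
  rewrite big_mkcond big_ord_recl /= add0r sumr_const card_ord -[_ *+ Num.truncn Q]mulr_natl.
  apply: (@le_trans _ _ (Q * (2 `^ s * M `^ s * (2 * Q / T)))).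
    apply: ler_wpM2r; last by rewrite truncn_le ltW.
    by rewrite mulr_ge0 ?divr_ge0 ?mulr_ge0 ?powR_ge0 ?(ltW Q0) ?(ltW T0).
  by rewrite le_eqVlt; apply/orP; left; apply/eqP; ring.
rewrite -mulr_sumr ler_wpM2l// exchange_big /=.
apply: ler_sum => m /andP[sm bm].
have [m1 mM _ mP] := smooth_crosses_le _ _ _ _ M1 sm bm.
have m0 : (0 < m)%N by exact: ltnW.
have mk0 : (0 < m ^ k)%N by rewrite expn_gt0 m0.
have glt (q : 'I_n) : (0 < q)%N -> (gcdn q (m ^ k) < n)%N.
  by move=> q0; rewrite (leq_ltn_trans _ (ltn_ord q))// dvdn_leq// dvdn_gcdl.
rewrite (partition_big (fun q : 'I_n => inord (gcdn q (m ^ k)) : 'I_n)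
   (fun g : 'I_n => (0 < g)%N && (g %| m ^ k)%N)) /=; last first.
  by move=> q q0; rewrite inordK ?glt// gcdn_gt0 q0 dvdn_gcdr.
rewrite mulr_sumr; apply: ler_sum => g /andP[g0 gm].
have g0' : (0 : R) < g%:R by rewrite ltr0n.
have arc0 q : 0 <= arcq R (fun x => hm m ((m ^ k)%:R * x)) Q T q.
  by apply: sumr_ge0 => a _; apply: Int_ge0 => x; exact: fabs_pow_ge0.
set e := (s - 1) / k%:R.
apply: (@le_trans _ _ (\sum_(q < n | (0 < q)%N && (gcdn q (m ^ k) == g))
  (M * Rr) `^ (s - 1) * g%:R `^ (- e) * arcq R (fun x => hm m ((m ^ k)%:R * x)) Q T q)).
  rewrite [leLHS](eq_bigl (fun q : 'I_n => (0 < q)%N && (gcdn q (m ^ k) == g)%N)); last first.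
    by move=> q; case q0: (0 < q)%N => //=; rewrite -val_eqE /= inordK ?glt.
  apply: ler_sum => q /andP[q0 /eqP gE].
  rewrite ler_wpM2r// -gE; apply: weight_le => //; nra.
rewrite -mulr_sumr.
have := arcsum_scale R (hm m) Q T (m ^ k) g (fabs_pow_cont _ _ _ _ s1) (fabs_pow_ge0 _ _ _ _) (fabs_pow_per _ _ _ _) mk0 T0 Q0 g0.
move=> /(ler_wpM2l (mulr_ge0 (powR_ge0 (M * Rr) (s - 1)) (powR_ge0 g%:R (- e)))).
move=> /le_trans; apply; rewrite /T natrX -expr_div_n.
rewrite [g%:R `^ (1 - _)]powRD; last by rewrite (gt_eqF g0') implybT.
rewrite powRr1 ?ler0n// -/(hm m) le_eqVlt; apply/orP; left; apply/eqP.

ring.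
Qed.

End Recursion.

(** * The induction on Q *)

Section Induction.
(** [Y] and [X] bound all lengths from below and above, [Rmax] all smoothness parameters; [Psi] and
    [B0] stand for constants times small powers of P. They stay fixed during the induction, so the
    final constant [A] is independent of Q. *)
Variables (R : realType) (k : nat) (s D c X Y Rmax Psi B0 : R).
Hypotheses (k0 : (0 < k)%N) (s1 : 1 <= s) (Dks : k%:R - s <= D).
Local Notation e := (1 - (s - 1) / k%:R).
Hypothesis eD : e <= 0 \/ e - 2 * D / k%:R <= - c.
Hypotheses (c0 : 0 <= c) (Y1 : 1 <= Y) (Rmax1 : 1 <= Rmax) (Psi1 : 1 <= Psi).
Hypothesis B00 : 0 <= B0.
Hypothesis U_bound : forall N pi : R, Y <= N -> N <= X -> 1 <= pi -> pi <= Rmax ->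
  Int R (fabs_pow R k s N pi) 0 1 <= B0 * N `^ (s - k%:R + D).
Hypothesis Psi_bound : forall q Z : nat, (0 < q)%N -> (0 < Z)%N ->
  q%:R <= X ^+ k -> Z%:R <= X ^+ k ->
  \sum_(d < Z.+1 | (0 < d)%N && \pi(q).-nat d) 1 <= Psi.
(** Loss of one pass: Psi^(s-1) from the power mean and one more Psi from the number of g dividing
    m^k; Rmax^s because m is located only between M and M Rr. *)
Let L : R := 4 `^ s * Psi `^ s * Rmax `^ s.
Hypothesis LY : L * Y `^ (- c) <= 2^-1.
(** 3 from the packing, [B0] from the complete mean value, and a power comparing N^D with Q^(2D/k);
    the absolute value covers either sign of [D]. *)
Let A1 : R := 3 * B0 * (4 * Rmax * Y) `^ `|D|.
(** Solves the recursive inequality: half of [A] pays for the terms that do not involve [A], the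
    other half for L Y^(-c) A. *)
Let A : R := 2 * (2 * 2 `^ s + L * Y * A1 + A1).

Let kR : (0 : R) < k%:R. Proof. by rewrite ltr0n. Qed.
Let L0 : 0 <= L. Proof. by rewrite !mulr_ge0 ?powR_ge0. Qed.
Let A10 : 0 <= A1. Proof. by rewrite !mulr_ge0 ?powR_ge0. Qed.
Let A0 : 0 <= A.
Proof.
by rewrite mulr_ge0// !addr_ge0 ?mulr_ge0 ?powR_ge0// (le_trans ler01).
Qed.
Let s0 : 0 < s. Proof. exact: lt_le_trans ltr01 s1. Qed.

Let zQ (Q : R) : 0 <= Q -> (Q `^ (2 / k%:R)) ^+ k = Q ^+ 2.
Proof.
move=> Q0; rewrite -powR_mulrn ?powR_ge0// -powRrM divfK ?gt_eqF//.
by rewrite powR_mulrn.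
Qed.

Let zD (Q : R) : (Q `^ (2 / k%:R)) `^ D = Q `^ (2 * D / k%:R).
Proof. by rewrite -powRrM; congr (_ `^ _); ring. Qed.

Let z1 (Q : R) : 1 <= Q -> 1 <= Q `^ (2 / k%:R).
Proof. by move=> Q1; apply: powR_ge1 => //; rewrite divr_ge0. Qed.

(** Disjointness holds since N^k >= (4 Q^(2/k))^k >= 4 Q^2. As N / Q^(2/k) lies between 1 and 4 Rmax
    Y, the mean value bound N^D turns into Q^(2D/k) at the cost in [A1]. *)
Lemma direct_bound (N pi Q Q' : R) : Y <= N -> N <= X -> 1 <= pi -> pi <= Rmax ->
  1 <= Q' -> Q' <= Q -> 4 * Q `^ (2 / k%:R) <= N ->
  N <= 4 * Rmax * Y * Q `^ (2 / k%:R) ->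
  arcsum R (fabs_pow R k s N pi) Q' (N ^+ k) <=
  A1 * N `^ (s - k%:R) * Q `^ (2 * D / k%:R).
Proof.
have s1' := s1; have Y1' := Y1; have Rm1' := Rmax1; have Ps1' := Psi1; have D' := Dks; have c0' := c0; have A10' := A10; have A0' := A0; have L0' := L0.
move=> YN NX pi1 piR Q'1 Q'Q zN Nz; have Q1 : 1 <= Q by lra.
have := z1 Q Q1; set z := Q `^ _ in zN Nz * => z1'.
have N1 : 1 <= N by lra.
have z0 : 0 < z by lra.
apply: (@le_trans _ _ (3 * Int R (fabs_pow R k s N pi) 0 1)).
  apply: arcsum_disjoint => //.
  - exact: fabs_pow_cont.
  - exact: fabs_pow_ge0.
  - exact: fabs_pow_per.
  - apply: (@lt_le_trans _ _ (4 * Q ^+ 2)); first by nra.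
    apply: (@le_trans _ _ ((4 * z) ^+ k)); last first.
      by rewrite lerXn2r ?nnegrE//; lra.
    rewrite exprMn zQ; last by lra.
    apply: ler_wpM2r; first exact: sqr_ge0.
    by rewrite -[leLHS]expr1 ler_weXn2l// ler1n.
apply: (@le_trans _ _ (3 * (B0 * N `^ (s - k%:R + D)))).
  by rewrite ler_wpM2l// U_bound.
rewrite powRD; last by rewrite (gt_eqF (lt_le_trans ltr01 N1)) implybT.
rewrite -zD -/z.
have t1 : 1 <= N / z by rewrite ler_pdivlMr//; lra.
have tD : (N / z) `^ D <= (4 * Rmax * Y) `^ `|D|.
  apply: (@le_trans _ _ ((N / z) `^ `|D|)).
    by apply: ler_powR => //; exact: ler_norm.
  apply: ge0_ler_powR; rewrite ?nnegrE ?normr_ge0//.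
  - by apply: (le_trans ler01).
  - by rewrite !mulr_ge0//; lra.
  - by rewrite ler_pdivrMr.
have -> : N `^ D = z `^ D * (N / z) `^ D.
  rewrite -powRM; [|lra|by apply: (le_trans ler01)].
  by rewrite [z * _]mulrC divfK// gt_eqF.
rewrite /A1.
have := ler_wpM2l (mulr_ge0 (mulr_ge0 (mulr_ge0 (ler0n R 3) B00) (powR_ge0 N (s - k%:R))) (powR_ge0 z D)) tD.
move=> H; rewrite (le_trans _ (le_trans H _))// le_eqVlt; apply/orP; left; apply/eqP; ring.
Qed.

(* Either g^e <= Y and the complete mean value is affordable, or g > Y and the
   induction hypothesis at Q / g gains the factor Y^(-c). *)
Lemma summand_bound (b Q N pi : R) (g : nat) :
  (forall Q P Rr : R, 1 <= Q -> 2 * Q <= b -> 1 <= Rr -> Rr <= Rmax -> Y <= P -> P <= X ->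
    4 * Q `^ (2 / k%:R) <= P ->
    arcsum R (fabs_pow R k s P Rr) Q (P ^+ k) <=
      A * P `^ (s - k%:R) * Q `^ (2 * D / k%:R)) ->
  1 <= Q -> Q <= b -> 1 <= pi -> pi <= Rmax -> Y <= N -> N <= X ->
  4 * Q `^ (2 / k%:R) <= N -> N <= 4 * Rmax * Y * Q `^ (2 / k%:R) ->
  (0 < g)%N -> g%:R <= Q ->
  g%:R `^ e * arcsum R (fabs_pow R k s N pi) (Q / g%:R) (N ^+ k) <=
  (Y * A1 + Y `^ (- c) * A) * (N `^ (s - k%:R) * Q `^ (2 * D / k%:R)).
Proof.
move=> IH Q1 Qb pi1 piR YN NX zN Nz g0 gQ.
have g1 : (1 : R) <= g%:R by rewrite ler1n.
have g0' : (0 : R) < g%:R by rewrite ltr0n.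
have Q0 : 0 < Q := lt_le_trans ltr01 Q1.
have Y0 : 0 < Y := lt_le_trans ltr01 Y1.
have Qg1 : 1 <= Q / g%:R by rewrite ler_pdivlMr// mul1r.
have QgQ : Q / g%:R <= Q by rewrite ler_pdivrMr// ler_peMr// ltW.
have G0 : 0 <= N `^ (s - k%:R) * Q `^ (2 * D / k%:R) by rewrite mulr_ge0 ?powR_ge0.
rewrite [(Y * A1 + _) * _]mulrDl; have [ge|ge] := leP (g%:R `^ e) Y.
  apply: (@le_trans _ _ (Y * A1 * (N `^ (s - k%:R) * Q `^ (2 * D / k%:R)))); last first.
    by rewrite lerDl; apply: (mulr_ge0 (mulr_ge0 (powR_ge0 _ _) A0) G0).
  rewrite -mulrA; apply: ler_pM; [exact: powR_ge0| |exact: ge|].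
    by apply: arcsum_ge0; exact: fabs_pow_ge0.
  by rewrite mulrA; exact: direct_bound.
have e0 : 0 < e.
  rewrite ltNge; apply/negP => e0; have := lt_le_trans ge (powR_le1 _ _ _ g1 e0).
  by rewrite ltNge Y1.
have eD' : e - 2 * D / k%:R <= - c by case: eD => //; rewrite leNgt e0.
have e1 : e <= 1 by rewrite gerBl divr_ge0 ?(ltW kR)// subr_ge0.
have gY : Y <= g%:R.
  apply: (le_trans (ltW ge)); rewrite -[leRHS](@powRr1 _ g%:R)//.
  exact: ler_powR.
(* g = 1 is impossible, since then g^e = 1 <= Y. So Q/g <= Q/2, as the induction hypothesis
   demands. *)
have g2 : (2 : R) <= g%:R.
  case: g {gQ g1 g0' Qg1 QgQ gY} g0 ge => [|[|g]] // _; last by rewrite ler_nat.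
  by rewrite powR1 ltNge Y1.
apply: (@le_trans _ _ (Y `^ (- c) * A * (N `^ (s - k%:R) * Q `^ (2 * D / k%:R)))); last first.
  by rewrite lerDr; apply: (mulr_ge0 (mulr_ge0 (ltW Y0) A10) G0).
have zg : 4 * (Q / g%:R) `^ (2 / k%:R) <= N.
  apply: le_trans zN; apply: ler_wpM2l => //.
  apply: ge0_ler_powR; rewrite ?nnegrE ?(le_trans ler01 Qg1) ?(ltW Q0)//.
have Qgb : 2 * (Q / g%:R) <= b.
  apply: le_trans Qb; rewrite mulrCA -[leRHS]mulr1; apply: ler_wpM2l; first exact: ltW.
  by rewrite ler_pdivrMr// mul1r.
have IH' := IH (Q / g%:R) N pi Qg1 Qgb pi1 piR YN NX zg.
apply: (le_trans (ler_wpM2l (powR_ge0 _ _) IH')).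
rewrite (powR_div _ _ _ _ (ltW Q0) g0').
have gc : g%:R `^ e / g%:R `^ (2 * D / k%:R) <= Y `^ (- c).
  rewrite -powRB; last by rewrite (gt_eqF g0') implybT.
  apply: (@le_trans _ _ (g%:R `^ (- c))); first exact: ler_powR.
  rewrite !powRN lef_pV2 ?posrE ?powR_gt0//.
  by apply: ge0_ler_powR; rewrite ?nnegrE ?(ltW Y0).
have := ler_wpM2r (mulr_ge0 A0 G0) gc.
by move=> H; rewrite (le_trans _ (le_trans H _))// le_eqVlt; apply/orP; left; apply/eqP; ring.
Qed.

Lemma arcsum_induction_step (b : R) :
  (forall Q P Rr : R, 1 <= Q -> 2 * Q <= b -> 1 <= Rr -> Rr <= Rmax -> Y <= P -> P <= X ->
    4 * Q `^ (2 / k%:R) <= P ->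
    arcsum R (fabs_pow R k s P Rr) Q (P ^+ k) <=
      A * P `^ (s - k%:R) * Q `^ (2 * D / k%:R)) ->
  forall Q P Rr : R, 1 <= Q -> Q <= b -> 1 <= Rr -> Rr <= Rmax -> Y <= P -> P <= X ->
    4 * Q `^ (2 / k%:R) <= P ->
    arcsum R (fabs_pow R k s P Rr) Q (P ^+ k) <=
      A * P `^ (s - k%:R) * Q `^ (2 * D / k%:R).
Proof.
have s1' := s1; have Y1' := Y1; have Rm1' := Rmax1; have Ps1' := Psi1; have D' := Dks; have c0' := c0; have A10' := A10; have A0' := A0; have L0' := L0.
move=> IH Q P Rr Q1 Qb R1 RR YP PX zP.
have P1 : 1 <= P by lra.
have P0 : 0 < P by lra.
have X1 : 1 <= X by lra.
have z1' := z1 Q Q1; set z := Q `^ _ in zP z1'.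
have z0 : 0 < z by lra.
(* The least length at which both the arcs up to Q are disjoint and [U_bound] applies. *)
pose Nm := Num.max (4 * z) Y.
have Nm4 : 4 * z <= Nm by rewrite le_max lexx.
have NmY : Y <= Nm by rewrite le_max lexx orbT.
have NmU : Nm <= 4 * Y * z by rewrite ge_max; apply/andP; split; nra.
have PsD : 0 <= P `^ (s - k%:R) * Q `^ (2 * D / k%:R) by rewrite mulr_ge0 ?powR_ge0.
have QX : Q <= X ^+ k.
  have : Q ^+ 2 <= X ^+ k.
    by rewrite -zQ -/z; [rewrite lerXn2r ?nnegrE//; lra|lra].
  apply: le_trans; nra.
(* If P < Rr Nm, the M chosen below would be less than 1, but then P is already short enough for
   [direct_bound]. *)
have [PRN|RNP] := ltP P (Rr * Nm).
  rewrite -mulrA; apply: (@le_trans _ _ (A1 * (P `^ (s - k%:R) * Q `^ (2 * D / k%:R)))).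
    rewrite mulrA; apply: direct_bound => //.
    apply: (le_trans (ltW PRN)); rewrite -/z.
    apply: (@le_trans _ _ (Rmax * (4 * Y * z))); last by rewrite le_eqVlt; apply/orP; left; apply/eqP; ring.
    by apply: ler_pM => //; lra.
  rewrite ler_wpM2r// /A.
  have : 0 <= 2 `^ s :> R by exact: powR_ge0.
  have : 0 <= L * Y * A1 by apply: mulr_ge0 => //; apply: mulr_ge0 => //; lra.
  by have := A10; lra.
have Nm1 : 1 <= Nm by lra.
have RN1 : 1 <= Rr * Nm by nra.
(* With this M, the range M < m <= M Rr becomes Nm <= P/m < Rr Nm, the window of lengths for
   [direct_bound]. *)
pose M := P / (Rr * Nm).
have RN0 : 0 < Rr * Nm := lt_le_trans ltr01 RN1.
have M1 : 1 <= M by rewrite /M ler_pdivlMr// mul1r.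
have MR : M * Rr = P / Nm by rewrite /M; field; rewrite !gt_eqF//; lra.
have MRP : M * Rr <= P by rewrite MR ler_pdivrMr; nra.
have MP : M <= P by apply: le_trans MRP; nra.
have Mz : M <= P / z.
  rewrite /M ler_pM2l; last by lra.
  by rewrite lef_pV2 ?posrE//; nra.
have XXk : X <= X ^+ k.
  by rewrite -{1}[X]expr1 ler_weXn2l.
have cnt (q : nat) : (0 < q)%N -> q%:R <= Q ->
    \sum_(d < (Num.truncn (M * Rr)).+1 | (0 < d)%N && \pi(q).-nat d) 1 <= Psi.
  move=> q0 qQ; apply: Psi_bound => //.
  - by rewrite truncn_gt0; nra.
  - exact: le_trans QX.
  - by apply: (le_trans _ (le_trans PX XXk)); apply: le_trans MRP; rewrite truncn_le; nra.
have Psi0 : 0 < Psi by lra.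
apply: (le_trans (arcsum_recursion _ _ _ _ M _ _ _ k0 s1 M1 MP R1 Q1 Psi0 cnt)).
pose W := Y * A1 + Y `^ (- c) * A.
have W0 : 0 <= W.
  by apply: addr_ge0; apply: mulr_ge0 => //; [lra|exact: powR_ge0].
have term (m g : nat) : (0 < g)%N -> g%:R <= Q -> smoothb P Rr m -> crosses R M m ->
   g%:R `^ e * arcsum R (fabs_pow R k s (P / m%:R) (pdiv m)%:R) (Q / g%:R) ((P / m%:R) ^+ k)
   <= W * ((P / m%:R) `^ (s - k%:R) * Q `^ (2 * D / k%:R)).
  move=> g0 gQ sm bm.
  have [m1 mM pR mP] := smooth_crosses_le _ _ _ _ _ M1 sm bm.
  have m0' : (0 : R) < m%:R by rewrite ltr0n ltnW.
  have p1 : (1 : R) <= (pdiv m)%:R by rewrite ler1n pdiv_gt0.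
  have NmP : Nm <= P / m%:R.
    by rewrite ler_pdivlMr// mulrC -ler_pdivlMr; [rewrite -MR|exact: lt_le_trans ltr01 Nm1].
  have PmU : P / m%:R <= Rr * Nm.
    have /andP[Mm _] := bm.
    by rewrite ler_pdivrMr// mulrC -ler_pdivrMr// -/M ltW.
  have PmX : P / m%:R <= X.
    by apply: le_trans PX; rewrite ler_pdivrMr// ler_peMr ?ler1n ?(ltnW m1)// ltW.
  apply: (summand_bound b) => //.
  - exact: le_trans RR.
  - exact: le_trans NmP.
  - exact: le_trans Nm4 NmP.
  - apply: (le_trans PmU); apply: (@le_trans _ _ (Rmax * (4 * Y * z))).
      by apply: ler_pM => //; [exact: le_trans ler01 R1|exact: le_trans ler01 Nm1].
    by rewrite -/z le_eqVlt; apply/orP; left; apply/eqP; ring.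
have M0 : 0 < M := lt_le_trans ltr01 M1.
have R0 : 0 < Rr := lt_le_trans ltr01 R1.
have MR0 : 0 < M * Rr := mulr_gt0 M0 R0.
have Q0 : 0 < Q := lt_le_trans ltr01 Q1.
set Qd := Q `^ (2 * D / k%:R) in PsD term *.
have Qd0 : 0 <= Qd by exact: powR_ge0.
(* The part x <= M: from M <= P/z and Q^2 = z^k, the quantity M^s Q^2 / P^k is at most P^(s-k)
   z^(k-s), and D >= k - s with z >= 1 concludes. *)
have first : 2 `^ s * M `^ s * (2 * Q ^+ 2 / P ^+ k) <= 2 * 2 `^ s * (P `^ (s - k%:R) * Qd).
  have h : M `^ s * (Q ^+ 2 / P ^+ k) <= P `^ (s - k%:R) * Qd.
    apply: (@le_trans _ _ ((P / z) `^ s * (z ^+ k / P ^+ k))).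
      rewrite zQ; last by lra.
      apply: ler_wpM2r; first by rewrite divr_ge0 ?sqr_ge0// exprn_ge0// ltW.
      by apply: ge0_ler_powR; rewrite ?nnegrE ?(ltW M0) ?(ltW s0) ?divr_ge0 ?(ltW z0) ?(ltW P0).
    have zz : z `^ (k%:R - s) <= Qd by rewrite /Qd -zD -/z; apply: ler_powR.
    apply: (@le_trans _ _ (P `^ (s - k%:R) * z `^ (k%:R - s))); last first.
      by rewrite ler_wpM2l ?powR_ge0.
    rewrite (powR_div _ _ _ _ (ltW P0) z0) !powRB ?(gt_eqF P0) ?(gt_eqF z0) ?implybT// !powR_mulrn ?(ltW z0) ?(ltW P0)//.
    rewrite le_eqVlt; apply/orP; left; apply/eqP; ring.
  have := ler_wpM2l (mulr_ge0 (ler0n R 2) (powR_ge0 2 s)) h.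
  by move=> H; rewrite (le_trans _ H)// le_eqVlt; apply/orP; left; apply/eqP; ring.
(* A bound for the m-th term free of m: the factor m^(-s) arising from (P/m)^(s-k) / m^k is replaced
   by M^(-s). *)
pose c2 := (M * Rr) `^ (s - 1) * M `^ (- s) * (W * Psi * (P `^ (s - k%:R) * Qd)).
have c20 : 0 <= c2.
  apply: mulr_ge0; first by apply: mulr_ge0; exact: powR_ge0.
  by apply: mulr_ge0 => //; apply: mulr_ge0 => //; lra.
have inner (m : 'I_(Num.truncn P).+1) : smoothb P Rr m && crosses R M m ->
    (M * Rr) `^ (s - 1) / (m ^ k)%:R *
    \sum_(g < (Num.truncn Q).+1 | (0 < g)%N && (g %| m ^ k)%N)
      g%:R `^ e * arcsum R (fabs_pow R k s (P / m%:R) (pdiv m)%:R) (Q / g%:R) ((P / m%:R) ^+ k) <= c2.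
  move=> /andP[sm bm]; have [m1 mM pR mP] := smooth_crosses_le _ _ _ _ _ M1 sm bm.
  have m0 : (0 < m)%N by exact: ltnW.
  have m0' : (0 : R) < m%:R by rewrite ltr0n.
  have Mm : M < m%:R by case/andP: bm.
  set Gm := (P / m%:R) `^ (s - k%:R) * Qd.
  have Gm0 : 0 <= Gm by rewrite mulr_ge0 ?powR_ge0.
  apply: (@le_trans _ _ ((M * Rr) `^ (s - 1) / (m ^ k)%:R * (W * Gm * Psi))).
    apply: ler_wpM2l; first by rewrite divr_ge0 ?powR_ge0.
    apply: (@le_trans _ _ (\sum_(g < (Num.truncn Q).+1 | (0 < g)%N && (g %| m ^ k)%N) W * Gm)).
      apply: ler_sum => g /andP[g0 gm]; apply: term => //.
      by rewrite -truncn_ge_nat; [rewrite -ltnS ltn_ord|lra].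
    (* Here m plays the part of q: every g dividing m^k is composed of primes of m. *)
    have cntg := Psi_bound m (Num.truncn Q) m0 _ (le_trans mP (le_trans PX XXk)) _.
    have {}cntg : \sum_(d < (Num.truncn Q).+1 | (0 < d)%N && \pi(m).-nat d) (1 : R) <= Psi.
      apply: cntg; first by rewrite truncn_gt0.
      by apply: le_trans QX; rewrite truncn_le; lra.
    apply: (@le_trans _ _ (W * Gm * \sum_(d < (Num.truncn Q).+1 | (0 < d)%N && \pi(m).-nat d) (1 : R))); last first.
      by apply: ler_wpM2l => //; apply: mulr_ge0.
    rewrite mulr_sumr mulr1 big_mkcond [leRHS]big_mkcond; apply: ler_sum => g _.
    case: ifPn => [/andP[g0 gm]|_]; last by case: ifP => // _; apply: mulr_ge0.
    by rewrite g0 (pnat_dvd gm)// pnatX pnat_pi.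
  have mk : (P / m%:R) `^ (s - k%:R) / (m ^ k)%:R <= P `^ (s - k%:R) * M `^ (- s).
    rewrite (powR_div _ _ _ _ (ltW P0) m0').
    rewrite -mulrA ler_wpM2l ?powR_ge0// natrX -powR_mulrn ?ler0n//.
    rewrite -invfM -powRD; last by rewrite (gt_eqF m0') implybT.
    rewrite subrK powRN lef_pV2 ?posrE ?powR_gt0//.
    by apply: ge0_ler_powR; rewrite ?nnegrE ?(ltW s0) ?(ltW M0) ?(ltW m0') ?(ltW Mm).
  have nn : 0 <= (M * Rr) `^ (s - 1) * W * Psi * Qd.
    apply: mulr_ge0 => //; apply: mulr_ge0; last by lra.
    by apply: mulr_ge0 => //; exact: powR_ge0.
  have := ler_wpM2l nn mk.
  move=> H; rewrite (le_trans _ (le_trans H _))// le_eqVlt; apply/orP; left; apply/eqP.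
    by rewrite /Gm; ring.
  by rewrite /c2; ring.
have second : 4 `^ s * Psi `^ (s - 1) *
  \sum_(m < (Num.truncn P).+1 | smoothb P Rr m && crosses _ M m)
    (M * Rr) `^ (s - 1) / (m ^ k)%:R *
    \sum_(g < (Num.truncn Q).+1 | (0 < g)%N && (g %| m ^ k)%N)
      g%:R `^ e * arcsum R (fabs_pow R k s (P / m%:R) (pdiv m)%:R) (Q / g%:R) ((P / m%:R) ^+ k) <=
   L * W * (P `^ (s - k%:R) * Qd).
  apply: (@le_trans _ _ (4 `^ s * Psi `^ (s - 1) * (M * Rr * c2))).
    apply: ler_wpM2l; first by rewrite mulr_ge0 ?powR_ge0.
    apply: (@le_trans _ _ (\sum_(m < (Num.truncn P).+1 | smoothb P Rr m && crosses _ M m) c2)).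
      by apply: ler_sum => m; exact: inner.
    apply: (le_trans (sum_smooth_crosses_le _ P M Rr (fun=> c2) M1 R1 (fun=> c20))).
    rewrite big_mkcond big_ord_recl /= add0r sumr_const card_ord -[_ *+ _]mulr_natl.
    by apply: ler_wpM2r => //; rewrite truncn_le ltW.
  have -> : 4 `^ s * Psi `^ (s - 1) * (M * Rr * c2) =
     4 `^ s * (Psi * Psi `^ (s - 1)) * ((M * Rr * (M * Rr) `^ (s - 1)) * M `^ (- s)) * (W * (P `^ (s - k%:R) * Qd)).
    by rewrite /c2; ring.
  rewrite !mulr_powRB1 ?(ltW Psi0) ?(ltW MR0)//.
  have -> : (M * Rr) `^ s * M `^ (- s) = Rr `^ s.
    rewrite (powRM _ (ltW M0) (ltW R0)) powRN.
    by rewrite mulrAC divff ?mul1r// gt_eqF// powR_gt0.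
  rewrite -[leRHS]mulrA; apply: ler_wpM2r; first exact: mulr_ge0.
  apply: ler_wpM2l; first by rewrite mulr_ge0 ?powR_ge0.
  by apply: ge0_ler_powR; rewrite ?nnegrE ?(ltW s0)//; lra.
apply: (le_trans (lerD first second)).
rewrite -mulrDl -mulrA; apply: ler_wpM2r => //.
(* The only place where the loss of a pass meets the gain: by [LY] the term carrying [A] comes back
   at most halved. *)
have LA : L * (Y `^ (- c) * A) <= 2^-1 * A by rewrite mulrA; apply: ler_wpM2r.
have -> : L * W = L * Y * A1 + L * (Y `^ (- c) * A) by rewrite /W; ring.
have AE : A = 2 * (2 * 2 `^ s + L * Y * A1 + A1) by [].
have : 0 <= L * Y * A1 by apply: mulr_ge0 => //; apply: mulr_ge0 => //; lra.
move: LA AE; set u := L * (_ * _); set v := L * Y * A1; set t := 2 `^ s; lra.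
Qed.

(** Induction on j for Q <= 2^j, with the same [A] at each j. *)
Lemma arcsum_bound (Q P Rr : R) : 1 <= Q -> 1 <= Rr -> Rr <= Rmax -> Y <= P -> P <= X ->
    4 * Q `^ (2 / k%:R) <= P ->
    arcsum R (fabs_pow R k s P Rr) Q (P ^+ k) <=
      A * P `^ (s - k%:R) * Q `^ (2 * D / k%:R).
Proof.
suff H (j : nat) : forall Q P Rr : R, 1 <= Q -> Q <= 2 ^+ j -> 1 <= Rr -> Rr <= Rmax ->
    Y <= P -> P <= X -> 4 * Q `^ (2 / k%:R) <= P ->
    arcsum R (fabs_pow R k s P Rr) Q (P ^+ k) <=
      A * P `^ (s - k%:R) * Q `^ (2 * D / k%:R).
  move=> Q1 *; apply: (H (Num.truncn Q).+1) => //.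
  apply: (le_trans (ltW (truncnS_gt _))).
  by rewrite -natrX ler_nat ltnW// ltn_expl.
elim: j => [|j IH]; apply: arcsum_induction_step.
  (* For b = 1 the induction hypothesis is vacuous: 2 q <= 1 contradicts q >= 1. *)
  by rewrite expr0 => q *; lra.
by move=> q p r q1 qj; apply: IH => //; move: qj; rewrite exprS ler_pM2l.
Qed.

End Induction.

(** * Lower bound for admissible exponents *)

Section LowerBound.
Variable R : realType.
Implicit Types (k : nat).

Lemma Int_cos_harmonic (w : R) : w != 0 -> sin w = 0 ->
  Int R (fun x => cos (w * x)) 0 1 = 0.
Proof.
move=> w0 sw; apply: EFin_inj.
have cf : continuous (fun x : R => cos (w * x)).
  have cl : continuous (fun x : R => w * x).
    by move=> x; apply: cvgM; [exact: cvg_cst|exact: cvg_id].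
  by move=> x; exact: (continuous_comp (cl x) (@continuous_cos R _)).
pose F (x : R) := w^-1 * sin (w * x).
have dF (x : R) : is_derive x 1 F (cos (w * x)).
  have := is_derive_affine R w 0 x; under eq_fun do rewrite addr0.
  move=> dl; have dc := @is_derive1_comp R (@sin R) _ x _ _ (is_derive_sin (w * x)) dl.
  rewrite -[cos _](mulKf w0) [w * cos _]mulrC.
  exact: (is_deriveZ (f := @sin R \o (fun x : R => w * x) : R -> R^o)).
rewrite -EFin_Int// (continuous_FTC2 (F := F))//.
- by rewrite /F mulr1 sw mulr0 mulr0 sin0 mulr0 -EFinD subrr.
- exact: continuous_subspaceT.
- have cF : continuous F.
    by move=> x; apply: differentiable_continuous; apply/derivable1_diffP; exact: ex_derive.
  by split => //; [apply: cvg_at_right_filter|apply: cvg_at_left_filter]; exact: cF.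
- by move=> x _; rewrite derive1E; apply: derive_val.
Qed.

Lemma sin_2pin (n : nat) : sin (2 * pi * n%:R : R) = 0.
Proof.
have -> : 2 * pi * n%:R = 0 + (pi *+ 2) *+ n :> R.
  by rewrite -[(pi *+ 2) *+ n]mulr_natr -[pi *+ 2]mulr_natl; ring.
by rewrite (periodicn (@sinD2pi R)) sin0.
Qed.

(** Orthogonality: the integrand is the cosine of frequency x^k - y^k. Taking y <= x first lets this
    difference be a natural number. *)
Lemma Int_cos_diff k (x y : nat) : (0 < k)%N ->
  Int R (fun a => cos (2 * pi * (a * x%:R ^+ k)) * cos (2 * pi * (a * y%:R ^+ k)) +
                  sin (2 * pi * (a * x%:R ^+ k)) * sin (2 * pi * (a * y%:R ^+ k))) 0 1
  = (x == y)%:R.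
Proof.
move=> k0; wlog yx : x y / (y <= x)%N => [W|].
  have [/W//|/ltnW/W E] := leqP y x.
  rewrite eq_sym -E; apply: eq_Int => a; ring.
rewrite (eq_Int _ _ (fun a => cos (2 * pi * (x ^ k - y ^ k)%N%:R * a))); last first.
  move=> a; rewrite -cosB; congr cos.
  by rewrite natrB ?leq_exp2r// !natrX; ring.
have [<-|ne] := eqVneq x y.
  rewrite (eq_Int _ _ (fun=> 1)) ?Int_cst ?subr0 ?mulr1// => a.
  by rewrite subnn mulr0 mul0r cos0.
apply: Int_cos_harmonic; last exact: sin_2pin.
rewrite mulf_neq0 ?mulf_neq0 ?gt_eqF ?pi_gt0// ltr0n subn_gt0 ltn_exp2r//.
by rewrite ltn_neqAle yx eq_sym ne.
Qed.

Definition smooth_count (P Rr : R) : R :=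
  \sum_(n < (Num.truncn P).+1 | smoothb P Rr n) 1.

Lemma parseval k (P Rr : R) : (0 < k)%N ->
  Int R (fun a => fabs k P Rr a ^+ 2) 0 1 = smooth_count P Rr.
Proof.
move=> k0; set N := (Num.truncn P).+1.
pose F (x y : nat) (a : R) : R :=
  cos (2 * pi * (a * x%:R ^+ k)) * cos (2 * pi * (a * y%:R ^+ k)) +
  sin (2 * pi * (a * x%:R ^+ k)) * sin (2 * pi * (a * y%:R ^+ k)).
have cF x y : continuous (F x y).
  have [c1 s1] := continuous_trig R k x; have [c2 s2] := continuous_trig R k y.
  by move=> a; apply: cvgD; apply: cvgM; [exact: c1|exact: c2|exact: s1|exact: s2].
rewrite (eq_Int _ _ (fun a => \sum_(x < N | smoothb P Rr x) \sum_(y < N | smoothb P Rr y) F x y a)); last first.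
  move=> a; rewrite /fabs sqr_sqrtr; last by rewrite addr_ge0 ?sqr_ge0.
  rewrite !expr2 /fRe /fIm !mulr_suml -big_split/=; apply: eq_bigr => x _.
  by rewrite !mulr_sumr -big_split.
rewrite Int_sum => [|x _]; last by apply: continuous_sumf => y _; exact: cF.
apply: eq_bigr => x sx; rewrite Int_sum => [|y _]; last exact: cF.
under eq_bigr do rewrite Int_cos_diff//.
rewrite (bigD1 x)//= eqxx big1 ?addr0// => y /andP[_ yx].
by rewrite -val_eqE eq_sym in yx; rewrite (negbTE yx).
Qed.

(* Pointwise y^s >= l (y^2 - N/2) with l = (N/2)^((s-2)/2). *)
Lemma moment_ge k (s P Rr : R) : (0 < k)%N -> 2 <= s ->
  (smooth_count P Rr / 2) `^ (s / 2) <= Int R (fabs_pow R k s P Rr) 0 1.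
Proof.
move=> k0 s2; set N := smooth_count P Rr.
have N0 : 0 <= N by apply: sumr_ge0.
have h0 : 0 <= N / 2 by lra.
pose l := (N / 2) `^ ((s - 2) / 2).
have l0 : 0 <= l by exact: powR_ge0.
have c2 : continuous (fun a => fabs k P Rr a ^+ 2).
  by move=> a; apply: cvgM; exact: continuous_fabs.
have pt a : l * (fabs k P Rr a ^+ 2 + - (N / 2)) <= fabs_pow R k s P Rr a.
  set y := fabs k P Rr a; have y0 : 0 <= y by exact: fabs_ge0.
  have [yN|Ny] := leP (y ^+ 2) (N / 2).
    by apply: (@le_trans _ _ 0); [rewrite mulr_ge0_le0//; lra|exact: powR_ge0].
  have -> : fabs_pow R k s P Rr a = (y ^+ 2) `^ ((s - 2) / 2) * y ^+ 2.
    rewrite /fabs_pow -/y -powR_mulrn// -powRrM.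
    have ypos : 0 < y by rewrite lt_neqAle y0 andbT; apply/eqP => y00; move: Ny; rewrite -y00 expr0n /=; lra.
    rewrite -powRD; last by rewrite (gt_eqF ypos) implybT.
    by congr (_ `^ _); field.
  apply: ler_pM => //; first by lra.
    by apply: ge0_ler_powR; rewrite ?nnegrE//; lra.
  lra.
have cc : continuous (fun a => fabs k P Rr a ^+ 2 + - (N / 2)).
  by move=> a; apply: cvgD; [exact: c2|exact: cvg_cst].
have clc : continuous (fun a => l * (fabs k P Rr a ^+ 2 + - (N / 2))).
  by move=> a; apply: cvgM; [exact: cvg_cst|exact: cc].
have hc : continuous (fabs_pow R k s P Rr) by apply: fabs_pow_cont; lra.
apply: le_trans (le_Int R _ _ 0 1 clc hc (fun x _ => pt x)).
(* The mean of y^2 is N, so the minorant integrates to l N/2 = (N/2)^(s/2). *)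
rewrite IntZ// IntD//; last by move=> a; exact: cvg_cst.
rewrite parseval// Int_cst// -/N subr0 mulr1.
have -> : N + - (N / 2) = N / 2 by field.
have -> : s / 2 = (s - 2) / 2 + 1 by field.
have [->|n0] := eqVneq (N / 2) 0; first by rewrite mulr0 powR0//; lra.
by rewrite powRD ?n0 ?implybT// powRr1.
Qed.

(** The classical count Psi(Z^t, Z) of Z-smooth integers, at integer parameters. *)
Definition psi (Z t : nat) : R :=
  \sum_(n < (Z ^ t).+1 | (0 < n)%N && all (fun p => p <= Z)%N (primes n)) 1.

Lemma smooth_count_psi (Z t : nat) : smooth_count (Z ^ t)%:R Z%:R = psi Z t.
Proof.
rewrite /smooth_count natrK; apply: eq_bigl => n.
have nZ : (n <= Z ^ t)%N by rewrite -ltnS ltn_ord.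
rewrite /smoothb ler_nat nZ /=.
by congr andb; apply: eq_all => p; rewrite ler_nat.
Qed.

(* Each x is a product z y with z <= Z in at most as many ways as it has divisors. *)
Lemma psi_step (Z t : nat) (B : R) : 0 <= B ->
  (forall x : nat, (0 < x)%N -> (x <= Z ^ t.+1)%N ->
    \sum_(z < Z.+1 | (0 < z)%N && (z %| x)%N) 1 <= B) ->
  Z%:R * psi Z t <= B * psi Z t.+1.
Proof.
move=> B0 HB.
apply: (@le_trans _ _ (\sum_(x < (Z ^ t.+1).+1 | (0 < x)%N && all (fun p => p <= Z)%N (primes x))
   \sum_(z < Z.+1 | (0 < z)%N && (z %| x)%N) 1)); last first.
  rewrite mulr_sumr mulr1; apply: ler_sum => x /andP[x0 _]; apply: HB => //.
  by rewrite -ltnS.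
have -> : Z%:R * psi Z t = \sum_(z < Z.+1 | (0 < z)%N) psi Z t.
  by rewrite big_mkcond big_ord_recl /= add0r sumr_const card_ord -[RHS]mulr_natl.
rewrite /psi pair_big pair_big_dep /=.
have lt (z : 'I_Z.+1) (y : 'I_(Z ^ t).+1) : (z * y < (Z ^ t.+1).+1)%N.
  by rewrite ltnS expnS leq_mul// -ltnS.
apply: (@ler_sum_inj _ _ _ _ _ (fun x : 'I_Z.+1 * 'I_(Z ^ t).+1 =>
  (inord (x.1 * x.2) : 'I_(Z ^ t.+1).+1, x.1))) => //.
- move=> [z y] /= /andP[z0 /andP[y0 /allP ay]]; rewrite inordK// muln_gt0 z0 y0 dvdn_mulr//= andbT.
  apply/allP => p; rewrite primesM// => /orP[|/ay//].
  rewrite mem_primes => /and3P[_ _ /dvdn_leq pz]; apply: leq_trans (pz z0) _.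
  by rewrite -ltnS.
- move=> [z y] [z' y'] /= /andP[z0 _] /andP[z'0 _] [] /(congr1 (@nat_of_ord _)).
  rewrite !inordK// => E zz; subst z'; congr pair; apply: val_inj => /=.
  by apply/eqP; rewrite -(eqn_pmul2l z0) E.
Qed.

(** Divisors of x are composed of the primes of x, so [rankin] provides the bound B of [psi_step].
    Half of d is spent on B, the other half on the induction hypothesis. *)
Lemma psi_ge (t : nat) (d : R) : 0 < d -> exists2 c : R, 0 < c &
  forall Z : nat, (0 < Z)%N -> c * Z%:R `^ (t%:R - d) <= psi Z t.
Proof.
elim: t d => [|t IH] d d0.
  exists 1 => // Z Z0; rewrite /psi expn0 sub0r mul1r.
  rewrite big_mkcond !big_ord_recl big_ord0 /= add0r addr0.
  by apply: powR_le1; [rewrite ler1n|rewrite oppr_le0 ltW].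
have d2 : 0 < d / 2 by lra.
have [c c0 Hc] := IH _ d2.
have t2 : (0 : R) < t.+2%:R by rewrite ltr0n.
(* x <= Z^(t+1) costs Z^((t+1) e) and z <= Z another Z^e; the total (t+2) e is d/2. *)
pose e := d / 2 / t.+2%:R; have e0 : 0 < e by rewrite !divr_gt0.
have [C C1 HC] := rankin R e e0.
have C0 : 0 < C by lra.
exists (c / C); first by rewrite divr_gt0.
move=> Z Z0; have Z0' : (0 : R) < Z%:R by rewrite ltr0n.
have Zt : (0 < Z ^ t.+1)%N by rewrite expn_gt0 Z0.
have B0 : 0 <= C * Z%:R `^ (d / 2) by rewrite mulr_ge0 ?powR_ge0 ?(ltW C0).
have bnd (x : nat) : (0 < x)%N -> (x <= Z ^ t.+1)%N ->
    \sum_(z < Z.+1 | (0 < z)%N && (z %| x)%N) 1 <= C * Z%:R `^ (d / 2).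
  move=> x0 xZ; apply: (@le_trans _ _ (C * x%:R `^ e * Z%:R `^ e)).
    apply: le_trans (HC x Z x0 Z0).
    rewrite big_mkcond [leRHS]big_mkcond; apply: ler_sum => z _.
    case: ifPn => [/andP[z0 zx]|_]; last by case: ifP.
    by rewrite z0 (pnat_dvd zx)// pnat_pi.
  rewrite -mulrA; apply: ler_wpM2l; first exact: ltW.
  have -> : d / 2 = t.+1%:R * e + 1 * e.
    by rewrite -mulrDl natr1 [RHS]mulrC divfK// gt_eqF.
  rewrite mul1r.
  rewrite powRD; last by rewrite (gt_eqF Z0') implybT.
  apply: ler_wpM2r; first exact: powR_ge0.
  rewrite powRrM powR_mulrn ?ler0n// -natrX.
  by apply: ge0_ler_powR; rewrite ?nnegrE ?ler0n ?ler_nat ?(ltW e0).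
have st := psi_step Z t _ B0 bnd.
have Zd : 0 < Z%:R `^ (d / 2) :> R by exact: powR_gt0.
rewrite -(ler_pM2l (mulr_gt0 C0 Zd)); apply: le_trans st.
apply: (le_trans _ (ler_wpM2l (ler0n R Z) (Hc Z Z0))).
have -> : t.+1%:R - d = t%:R - d / 2 + 1 - d / 2 :> R by rewrite -natr1; field.
have zn (a b : R) : Z%:R `^ (a + b) = Z%:R `^ a * Z%:R `^ b :> R.
  by rewrite powRD// (gt_eqF Z0') implybT.
rewrite [Z%:R `^ (_ + 1 - d / 2)]zn [Z%:R `^ (_ + 1)]zn powRN powRr1 ?ler0n//.
rewrite le_eqVlt; apply/orP; left; apply/eqP; field.
by rewrite !gt_eqF.
Qed.

(* The definition of admissibility is tested at P = Z^t, R = Z, with 1/t <= eta. *)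
Lemma admissible_ge k (s D : R) : (0 < k)%N -> 2 <= s -> admissible k s D ->
  k%:R - s / 2 <= D.
Proof.
move=> k0 s2 adm; rewrite leNgt; apply/negP => Dlt.
(* The supposed deficit, so that s - k + D = s/2 - kap. The smooth count loses kap/4 through [d],
   admissibility kap/4 through its epsilon; the lower bound still exceeds the upper one by a factor
   P^(kap/2), up to constants. *)
pose kap := k%:R - s / 2 - D; have kap0 : 0 < kap by rewrite /kap; lra.
have s0 : 0 < s by lra.
have [eta [eta0 [C [P0 HC]]]] := adm (kap / 4) ltac:(lra).
pose t := (Num.truncn eta^-1).+1; have t0 : (0 : R) < t%:R by rewrite ltr0n.
have teta : t%:R^-1 <= eta.
  by rewrite -[eta]invrK lef_pV2 ?posrE ?invr_gt0//; apply/ltW/truncnS_gt.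
pose d := t%:R * kap / (2 * s); have d0 : 0 < d by rewrite !(divr_gt0, mulr_gt0).
have [c c0 Hc] := psi_ge t d d0.
pose C' := Num.max 1 C; have C'1 : 1 <= C' by rewrite le_max lexx.
pose b := (c / 2) `^ (s / 2); have b0 : 0 < b by apply: powR_gt0; lra.
(* Large enough that P >= Z passes [P0] and P^(kap/2) passes the ratio of the constants. *)
pose Z := (Num.truncn (Num.max P0 ((C' / b) `^ (2 / kap)))).+1.
have ZB : Num.max P0 ((C' / b) `^ (2 / kap)) < Z%:R by exact: truncnS_gt.
have Z0' : (0 : R) < Z%:R by rewrite ltr0n.
have Z1 : (1 : R) <= Z%:R by rewrite ler1n.
pose P : R := (Z ^ t)%:R.
have PE : P = Z%:R `^ t%:R by rewrite powR_mulrn ?ler0n// -natrX.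
have ZP : Z%:R <= P by rewrite ler_nat -{1}[Z]expn1 leq_pexp2l.
have P1 : 1 <= P := le_trans Z1 ZP.
have Pgt : 0 < P := lt_le_trans ltr01 P1.
have PP0 : P0 <= P.
  by apply: le_trans ZP; apply: (le_trans _ (ltW ZB)); rewrite le_max lexx.
have RP : Z%:R <= P `^ eta.
  rewrite PE -powRrM -{1}[Z%:R](powRr1 (ltW Z0')); apply: ler_powR => //.
  by rewrite -ler_pdivrMl// mulr1.
have := HC P Z%:R PP0 Z1 RP; rewrite /Us EFin_Int; last first.
  by apply: fabs_pow_cont; lra.
rewrite lee_fin => H.
have {}H := le_trans (moment_ge k s P Z%:R k0 s2) H.
have low : b * P `^ (s / 2 - kap / 4) <= (smooth_count P Z%:R / 2) `^ (s / 2).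
  have E : P `^ (s / 2 - kap / 4) = (Z%:R `^ (t%:R - d)) `^ (s / 2).
    rewrite PE -!powRrM; congr (_ `^ _); rewrite /d; field; by rewrite gt_eqF.
  rewrite E /b -powRM ?powR_ge0//; last by lra.
  apply: ge0_ler_powR; rewrite ?nnegrE.
  - lra.
  - by rewrite mulr_ge0 ?powR_ge0//; lra.
  - by rewrite divr_ge0//; apply: sumr_ge0.
  - by rewrite smooth_count_psi mulrAC ler_wpM2r// Hc.
have {}H := le_trans low H.
have {}H : b * P `^ (s / 2 - kap / 4) <= C' * P `^ (s - k%:R + D + kap / 4).
  by apply: (le_trans H); apply: ler_wpM2r; rewrite ?powR_ge0// le_max lexx orbT.
have E : s / 2 - kap / 4 = (s - k%:R + D + kap / 4) + kap / 2.
  by rewrite /kap; field.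
rewrite E powRD in H; last by rewrite (gt_eqF Pgt) implybT.
rewrite mulrCA mulrC ler_pM2r ?powR_gt0// in H.
have : C' / b < P `^ (kap / 2).
  have -> : C' / b = ((C' / b) `^ (2 / kap)) `^ (kap / 2).
    rewrite -powRrM (_ : 2 / kap * (kap / 2) = 1) ?powRr1//.
      by rewrite divr_ge0 ?(ltW b0)//; lra.
    by field; rewrite gt_eqF.
  apply: gt0_ltr_powR; rewrite ?nnegrE ?powR_ge0 ?(ltW Pgt)//; first lra.
  apply: lt_le_trans ZP; apply: le_lt_trans ZB; by rewrite le_max lexx orbT.
by rewrite ltr_pdivrMr// mulrC ltNge H.
Qed.

End LowerBound.

(** * From the major arcs to sums over arcs *)

Section MajorArcs.
Variable R : realType.
Notation mu := (@lebesgue_measure R).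
Implicit Types (h : R -> R).

Lemma integral_bigsetU_le (I : Type) (r : seq I) (p : pred I) (F : I -> set R) h :
  continuous h -> (forall x, 0 <= h x) -> (forall i, measurable (F i)) ->
  (\int[mu]_(x in \big[setU/set0]_(i <- r | p i) F i) (h x)%:E <=
   \sum_(i <- r | p i) \int[mu]_(x in F i) (h x)%:E)%E.
Proof.
move=> ch h0 mF.
have mh : measurable_fun setT h by exact: measurable_realfun.continuous_measurable_fun.
elim: r => [|i r IH]; first by rewrite !big_nil integral_set0.
rewrite !big_cons; case pi: (p i) => //.
set B := \big[setU/set0]_(j <- r | p j) F j.
have mB : measurable B by apply: bigsetU_measurable.
have mD : measurable ((F i `|` B) `\` F i) by apply: measurableD => //; apply: measurableU.
rewrite -(setDUK (@subsetUl _ (F i) B)) ge0_integral_setU//.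
- rewrite leeD2l//; apply: (le_trans _ IH); apply: ge0_subset_integral => //.
  + by apply/measurable_realfun.measurable_EFinP; exact: measurable_funTS.
  + by move=> x _; rewrite lee_fin.
  + by move=> x [[]].
- exact: mF.
- by apply/measurable_realfun.measurable_EFinP; exact: measurable_funTS.
- by move=> x _; rewrite lee_fin.
- by rewrite disj_set2E setDIK.
Qed.

Lemma arc_itvE (q a : nat) (w alpha : R) : (0 < q)%N ->
  (`|q%:R * alpha - a%:R| <= w) =
  (alpha \in `[a%:R / q%:R - w / q%:R, a%:R / q%:R + w / q%:R]).
Proof.
move=> q0; have q0' : (0 : R) < q%:R by rewrite ltr0n.
rewrite in_itv /= -mulrBl -mulrDl ler_pdivrMr// ler_pdivlMr// ler_norml.
by rewrite [alpha * _]mulrC; apply/idP/idP => /andP[? ?]; apply/andP; split; lra.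
Qed.

Lemma measurable_major_arcs k (Q P : R) : 0 < P -> measurable (major_arcs k Q P).
Proof.
move=> P0.
have -> : major_arcs k Q P = `[0, 1[%classic `&`
   \bigcup_(q in [set q : nat | (1 <= q)%N /\ q%:R <= Q])
   \bigcup_(a in [set a : nat | (a <= q)%N /\ coprime a q])
     [set` `[a%:R / q%:R - Q / P ^+ k / q%:R, a%:R / q%:R + Q / P ^+ k / q%:R] ].
  apply/seteqP; split => [x [x0 [x1 [q [a [q1 qQ aq caq]]]]]|x [x01 [q [q1 qQ] [a [aq caq] xa]]]].
    rewrite arc_itvE// => xa; split; first by rewrite /= in_itv/= x0.
    by exists q => //; exists a.
  move: x01; rewrite /= in_itv/= => /andP[x0 x1].
  by split => //; split => //; exists q, a; split => //; rewrite arc_itvE.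
apply: measurableI => //; apply: bigcup_measurable => q _; apply: bigcup_measurable => a _.
exact: measurable_itv.
Qed.

Lemma major_integral_le_Us k (s Q P Rr : R) : 1 <= s -> 0 < P ->
  (major_integral k s Q P Rr <= (Int R (fabs_pow R k s P Rr) 0 1)%:E)%E.
Proof.
move=> s1 P0; have ch := fabs_pow_cont R k s P Rr s1.
rewrite -EFin_Int//; apply: ge0_subset_integral => //.
- exact: measurable_major_arcs.
- apply/measurable_realfun.measurable_EFinP/measurable_funTS.
  exact: measurable_realfun.continuous_measurable_fun.
- by move=> x _; rewrite lee_fin; exact: fabs_pow_ge0.
- by move=> x [x0 [x1 _]]; rewrite /= in_itv/= x0 ltW.
Qed.

(* The residue a = q occurs only for q = 1, where its arc is the translate by 1
   of the arc at 0; this costs the factor 2. *)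
Lemma major_integral_le_arcsum k (s Q P Rr : R) : 1 <= s -> 0 < P -> 0 <= Q ->
  (major_integral k s Q P Rr <= (2 * arcsum R (fabs_pow R k s P Rr) Q (P ^+ k))%:E)%E.
Proof.
move=> s1 P0 Q0; have ch := fabs_pow_cont R k s P Rr s1.
have h0 := fabs_pow_ge0 R k s P Rr; set h := fabs_pow R k s P Rr in ch h0 *.
have mh : measurable_fun setT h by exact: measurable_realfun.continuous_measurable_fun.
set T := P ^+ k; set n := (Num.truncn Q).+1.
pose arc (q a : nat) : set R :=
  [set` `[a%:R / q%:R - Q / (q%:R * T), a%:R / q%:R + Q / (q%:R * T)] ].
pose arcs (q : nat) : set R := \big[setU/set0]_(a < q.+1 | coprime a q) arc q a.
have marc q a : measurable (arc q a) by exact: measurable_itv.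
have marcs q : measurable (arcs q) by apply: bigsetU_measurable.
have cover : major_arcs k Q P `<=` \big[setU/set0]_(q < n | (0 < q)%N) arcs q.
  move=> x [x0 [x1 [q [a [q1 qQ aq caq]]]]]; rewrite arc_itvE// => xa.
  have qn : (q < n)%N by rewrite ltnS truncn_ge_nat.
  have aq' : (a < q.+1)%N by [].
  rewrite (bigD1 (Ordinal qn))//=; left; rewrite /arcs (bigD1 (Ordinal aq'))//=; left.
  by rewrite /arc /= [q%:R * T]mulrC invfM mulrA.
apply: (@le_trans _ _ (\int[mu]_(x in \big[setU/set0]_(q < n | (0 < q)%N) arcs q) (h x)%:E)%E).
  apply: ge0_subset_integral => //.
  - exact: measurable_major_arcs.
  - by apply: bigsetU_measurable => q _; exact: marcs.
  - by apply/measurable_realfun.measurable_EFinP; exact: measurable_funTS.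
  - by move=> x _; rewrite lee_fin; exact: h0.
apply: (le_trans (integral_bigsetU_le 'I_n _ _ (fun q => arcs q) h ch h0 (fun q => marcs q))).
rewrite /arcsum -/n mulr_sumr -sumEFin; apply: lee_sum => q q0.
apply: (le_trans (integral_bigsetU_le 'I_q.+1 _ _ (fun a => arc q a) h ch h0 (fun a => marc q a))).
rewrite (eq_bigr (fun a : 'I_q.+1 => (Int R h (a%:R / q%:R - Q / (q%:R * T)) (a%:R / q%:R + Q / (q%:R * T)))%:E)); last first.
  by move=> a _; rewrite -EFin_Int.
rewrite sumEFin lee_fin big_mkcond big_ord_recr /= -big_mkcond /= mulrDl mul1r.
have -> : \sum_(a < q | coprime a q) Int R h (a%:R / q%:R - Q / (q%:R * T)) (a%:R / q%:R + Q / (q%:R * T)) = arcq R h Q T q by [].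
rewrite lerD2l; have arc0 : 0 <= arcq R h Q T q.
  by apply: sumr_ge0 => a _; exact: Int_ge0.
case: ifP => //; rewrite /coprime gcdnn => /eqP q1.
rewrite /arcq q1 big_mkcond big_ord1 /=.
have T0 : T != 0 by rewrite gt_eqF// exprn_gt0.
rewrite -[leRHS](Int_shift_nat _ _ 1)//; last exact: fabs_pow_per.
by rewrite le_eqVlt; apply/orP; left; apply/eqP; apply: (congr2 (Int R h)); field.
Qed.

End MajorArcs.

(** * The theorem *)

Section Exponents.
Variable R : realType.

(** The power of P contained in Psi^s Rmax^s: delta/8 from each of the two factors. *)
Lemma exponent_le (s kk delta eta : R) : 0 < s -> 0 < kk -> eta <= delta / (8 * s) ->
  s * (2 * kk * (delta / (16 * s * kk)) + eta) <= delta / 4.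
Proof.
move=> s0 kk0 h.
have -> : s * (2 * kk * (delta / (16 * s * kk)) + eta) = delta / 8 + s * eta.
  by field; rewrite !gt_eqF.
have := ler_wpM2l (ltW s0) h.
have -> : s * (delta / (8 * s)) = delta / 8 by field; rewrite gt_eqF.
lra.
Qed.

(** If s < k + 1, then s >= 2 forces k >= 2, and k - (s - 1) - 2 D <= 1 - k <= - k/2. This is the
    origin of c = 1/2. *)
Lemma exponent_gap (k : nat) (s D : R) : (0 < k)%N -> 2 <= s -> k%:R - s / 2 <= D ->
  1 - (s - 1) / k%:R <= 0 \/ 1 - (s - 1) / k%:R - 2 * D / k%:R <= - 2^-1.
Proof.
move=> k0 s2 Dge; have kR : (0 : R) < k%:R by rewrite ltr0n.
have [sk|ks] := leP (k%:R + 1) s.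
  by left; rewrite subr_le0 ler_pdivlMr// mul1r; lra.
right; have k2 : (2 : R) <= k%:R.
  rewrite ler_nat ltnNge; apply/negP => kle.
  have : (k%:R : R) <= 1 by rewrite (ler_nat R k 1).
  lra.
rewrite -(ler_pM2r kR).
have -> : (1 - (s - 1) / k%:R - 2 * D / k%:R) * k%:R = k%:R - (s - 1) - 2 * D.
  by field; rewrite gt_eqF.
lra.
Qed.

Lemma half_power_le (P d : R) : 1 <= P -> 0 <= d ->
  2^-1 * P `^ (d / 2) * P `^ d <= 2^-1 * P `^ (2 * d).
Proof.
move=> P1 d0; rewrite -mulrA; apply: ler_wpM2l => //.
rewrite -powRD; last by rewrite (gt_eqF (lt_le_trans ltr01 P1)) implybT.
by apply: ler_powR => //; lra.
Qed.

(** Converts the constant of [arcsum_bound] into a multiple of P^eps. S, V, A, F, W stand for 2^s,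
    P^(2 delta), [A1], 4^|Delta| and P^eps. *)
Lemma constant_le (S L Y V A C F W : R) : 0 <= S -> 0 <= A -> 1 <= V -> 1 <= W ->
  L * Y <= 2^-1 * V -> V * A <= 3 * C * F * W ->
  2 * (2 * S + L * Y * A + A) <= (4 * S + 12 * C * F) * W.
Proof.
move=> S0 A0 V1 W1 LY VA.
have := ler_wpM2r A0 LY; have := ler_wpM2r A0 V1; have := ler_wpM2l S0 W1; lra.
Qed.

End Exponents.

Theorem theorem4p2 (R : realType) (k : nat) (s Delta : R) :
  (1 <= k)%N -> 2 <= s -> admissible k s Delta ->
  forall eps : R, 0 < eps ->
  exists eta : R, 0 < eta /\
  exists C : R, exists P0 : R,
  forall P Rr Q : R, P0 <= P -> 2 <= Rr -> Rr <= P `^ eta ->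
    1 <= Q -> Q <= P `^ (k%:R / 2) ->
    (major_integral k s Q P Rr <=
       (C * P `^ (s - k%:R + eps) * Q `^ (2 * Delta / k%:R))%:E)%E.
Proof.
move=> k0 s2 adm eps eps0.
have Dge := admissible_ge R k s Delta k0 s2 adm.
have eD := exponent_gap R k s Delta k0 s2 Dge.
have kR : (0 : R) < k%:R by rewrite ltr0n.
have Dks : k%:R - s <= Delta by lra.
have s1 : 1 <= s by lra.
have s0 : 0 < s by lra.
pose dD : R := 1 + `|Delta|.
have dD0 : 0 < dD by rewrite /dD; have := normr_ge0 Delta; lra.
(* Makes 2 delta + 2 delta |Delta| = 2 delta [dD] at most eps/2; the remaining eps/2 is spent on
   admissibility. The bound 1 gives Y <= P. *)
pose delta := Num.min 1 (eps / (4 * dD)).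
have delta0 : 0 < delta by rewrite lt_min ltr01 !(divr_gt0, mulr_gt0).
have delta1 : delta <= 1 by rewrite ge_min lexx.
have deltae : delta * (4 * dD) <= eps.
  by rewrite -ler_pdivlMr ?mulr_gt0// ge_min lexx orbT.
have epsh : 0 < eps / 2 by lra.
have expo : 2 * delta + (eps / 2 + 2 * delta * `|Delta|) <= eps.
  by move: deltae; rewrite /dD; lra.
have [eta0 [eta00 [C0 [P00 HU]]]] := adm (eps / 2) epsh.
pose C0' := Num.max 1 C0.
have C01 : 1 <= C0' by rewrite le_max lexx.
(* The three bounds ensure Rmax <= Y, then Rmax <= Y^eta0, so that admissibility applies at all
   lengths N >= Y, and finally Rmax^s <= P^(delta/8). *)
pose eta := Num.min delta (Num.min (delta * eta0) (delta / (8 * s))).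
have eta_gt0 : 0 < eta by rewrite /eta lt_min delta0 lt_min mulr_gt0//= divr_gt0// mulr_gt0.
have etad : eta <= delta by rewrite ge_min lexx.
have etae : eta <= delta * eta0 by rewrite !ge_min lexx !orbT.
have etas : eta <= delta / (8 * s) by rewrite !ge_min lexx !orbT.
pose e1 := delta / (16 * s * k%:R).
have e10 : 0 < e1 by rewrite !(divr_gt0, mulr_gt0).
have [C1 C11 HC1] := rankin R e1 e10.
pose K0 := 4 `^ s * C1 `^ s.
have K00 : 0 < K0 by rewrite mulr_gt0// powR_gt0//; lra.
pose KA := 4 * 2 `^ s + 12 * C0' * 4 `^ `|Delta|.
exists eta; split=> //; exists (2 * KA).
(* Beyond this point Y >= [P00], where admissibility begins, and K0 <= P^(delta/4) / 2. *)
exists (Num.max 1 (Num.max ((Num.max 1 P00) `^ delta^-1) ((2 * K0) `^ (4 / delta)))).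
move=> P Rr Q; rewrite !ge_max => /and3P[P1 PP00 PK0] R2 RP Q1 QP.
have P0 : 0 < P := lt_le_trans ltr01 P1.
have Q0 : 0 < Q := lt_le_trans ltr01 Q1.
have powD (a b : R) : P `^ (a + b) = P `^ a * P `^ b.
  by rewrite powRD// (gt_eqF P0) implybT.
have powK (x a : R) : 0 < a -> 0 <= x -> x `^ a^-1 <= P -> x <= P `^ a.
  move=> a0 x0 xP; rewrite -[leLHS](powRr1 x0) -(mulVf (lt0r_neq0 a0)) powRrM.
  by apply: ge0_ler_powR; rewrite ?nnegrE ?powR_ge0 ?(ltW P0) ?(ltW a0).
pose Y := P `^ delta.
have YP00 : Num.max 1 P00 <= Y by apply: powK => //; rewrite le_max ler01.
have Y1 : 1 <= Y by apply: powR_ge1 => //; exact: ltW.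
have YP : Y <= P by rewrite -[leRHS](powRr1 (ltW P0)); apply: ler_powR.
have Y0 : 0 < Y := lt_le_trans ltr01 Y1.
pose Rmax := P `^ eta.
have Rmax1 : 1 <= Rmax by apply: powR_ge1 => //; exact: ltW.
have RmaxY : Rmax <= Y by apply: ler_powR.
have R1 : 1 <= Rr by lra.
(* Admissibility is used at length N <= P; its factor N^(eps/2) is enlarged to P^(eps/2) to be
   uniform in N. *)
pose B0 := C0' * P `^ (eps / 2).
have B00 : 0 <= B0 by rewrite mulr_ge0 ?powR_ge0//; lra.
have U_bound (N pi : R) : Y <= N -> N <= P -> 1 <= pi -> pi <= Rmax ->
    Int R (fabs_pow R k s N pi) 0 1 <= B0 * N `^ (s - k%:R + Delta).
  move=> YN NP pi1 piR.
  have N0 : 0 < N := lt_le_trans Y0 YN.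
  have NP00 : P00 <= N.
    by apply: le_trans YN; apply: le_trans YP00; rewrite le_max lexx orbT.
  have piN : pi <= N `^ eta0.
    apply: (le_trans piR); apply: (@le_trans _ _ (Y `^ eta0)).
      by rewrite /Y -powRrM; apply: ler_powR.
    by apply: ge0_ler_powR; rewrite ?nnegrE ?(ltW Y0) ?(ltW N0) ?(ltW eta00).
  have := HU N pi NP00 pi1 piN; rewrite /Us EFin_Int; last exact: fabs_pow_cont.
  rewrite lee_fin => /le_trans; apply.
  rewrite [N `^ _]powRD; last by rewrite (gt_eqF N0) implybT.
  apply: (@le_trans _ _ (C0' * (N `^ (s - k%:R + Delta) * N `^ (eps / 2)))).
    by apply: ler_wpM2r; [rewrite mulr_ge0 ?powR_ge0|rewrite le_max lexx orbT].
  rewrite /B0 -!mulrA; apply: ler_wpM2l; first by lra.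
  rewrite mulrC; apply: ler_wpM2r; first exact: powR_ge0.
  by apply: ge0_ler_powR; rewrite ?nnegrE ?(ltW P0) ?(ltW N0) ?(ltW epsh).
pose z := Q `^ (2 / k%:R).
have z1 : 1 <= z by apply: powR_ge1 => //; rewrite divr_ge0 ?(ltW kR).
have z0 : 0 < z := lt_le_trans ltr01 z1.
have zP : z <= P.
  have -> : P = (P `^ (k%:R / 2)) `^ (2 / k%:R).
    by rewrite -powRrM (_ : _ * _ = 1) ?powRr1 ?(ltW P0)//; field; rewrite gt_eqF.
  by apply: ge0_ler_powR; rewrite ?nnegrE ?divr_ge0 ?powR_ge0 ?(ltW Q0) ?(ltW kR).
have zD : Q `^ (2 * Delta / k%:R) = z `^ Delta.
  by rewrite /z -powRrM; congr (_ `^ _); ring.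
have nD : 0 <= `|Delta| by exact: normr_ge0.
have PG : 0 <= P `^ (s - k%:R) * z `^ Delta by rewrite mulr_ge0 ?powR_ge0.
have t2 : 0 <= 2 `^ s :> R by exact: powR_ge0.
have t4 : 0 <= 4 `^ `|Delta| :> R by exact: powR_ge0.
have Pe : 1 <= P `^ eps by apply: powR_ge1 => //; exact: ltW.
have goalE : 2 * KA * P `^ (s - k%:R + eps) * z `^ Delta =
    2 * KA * P `^ eps * (P `^ (s - k%:R) * z `^ Delta) by rewrite powD; ring.
rewrite zD goalE.
(* If P < 4 z, then P^Delta is at most 4^|Delta| z^Delta and the complete mean value suffices;
   otherwise P is long enough for [arcsum_bound]. *)
have [Pz|zP4] := ltP P (4 * z).
  apply: (le_trans (major_integral_le_Us R k s Q P Rr s1 P0)); rewrite lee_fin.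
  apply: (le_trans (U_bound P Rr YP (lexx P) R1 RP)).
  have PzD : P `^ Delta <= 4 `^ `|Delta| * z `^ Delta.
    have -> : P `^ Delta = (P / z) `^ Delta * z `^ Delta.
      by rewrite (powR_div _ _ _ _ (ltW P0) z0) divfK// gt_eqF// powR_gt0.
    apply: ler_wpM2r; first exact: powR_ge0.
    apply: (@le_trans _ _ ((P / z) `^ `|Delta|)).
      by apply: ler_powR; [rewrite ler_pdivlMr// mul1r|exact: ler_norm].
    by apply: ge0_ler_powR; rewrite ?nnegrE ?divr_ge0 ?(ltW P0) ?(ltW z0)// ler_pdivrMr// ltW.
  rewrite powD /B0.
  apply: (@le_trans _ _ (C0' * P `^ eps * (P `^ (s - k%:R) * (4 `^ `|Delta| * z `^ Delta)))).
    apply: ler_pM; rewrite ?mulr_ge0 ?powR_ge0//; first by lra.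
      by apply: ler_wpM2l; [lra|apply: ler_powR => //; lra].
    by apply: ler_wpM2l; [exact: powR_ge0|].
  have -> : C0' * P `^ eps * (P `^ (s - k%:R) * (4 `^ `|Delta| * z `^ Delta)) =
    C0' * 4 `^ `|Delta| * P `^ eps * (P `^ (s - k%:R) * z `^ Delta) by ring.
  apply: ler_wpM2r => //; apply: ler_wpM2r; first exact: powR_ge0.
  by rewrite /KA; nra.
apply: (le_trans (major_integral_le_arcsum R k s Q P Rr s1 P0 (ltW Q0))).
rewrite lee_fin -2!mulrA ler_pM2l//.
pose Psi := C1 * P `^ (2 * k%:R * e1).
have Psi1 : 1 <= Psi.
  have : 1 <= P `^ (2 * k%:R * e1) by apply: powR_ge1 => //; exact: mulr_ge0 (mulr_ge0 (ler0n _ 2) (ltW kR)) (ltW e10).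
  by rewrite /Psi; nra.
have Psi_bound (q Z : nat) : (0 < q)%N -> (0 < Z)%N -> q%:R <= P ^+ k -> Z%:R <= P ^+ k ->
    \sum_(d < Z.+1 | (0 < d)%N && \pi(q).-nat d) 1 <= Psi.
  move=> q0 Z0 qP ZP; apply: (le_trans (HC1 q Z q0 Z0)).
  have -> : Psi = C1 * (P ^+ k) `^ e1 * (P ^+ k) `^ e1.
    have -> : (P ^+ k) `^ e1 = P `^ (k%:R * e1).
      by rewrite -(powR_mulrn _ (ltW P0)) -powRrM.
    by rewrite /Psi -[RHS]mulrA -powD; congr (_ * _ `^ _); ring.
  have Pk0 : 0 <= P ^+ k by rewrite exprn_ge0 ?(ltW P0).
  have mono (x : nat) : x%:R <= P ^+ k -> x%:R `^ e1 <= (P ^+ k) `^ e1.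
    by move=> xP; apply: ge0_ler_powR; rewrite ?nnegrE ?ler0n ?(ltW e10)//.
  apply: ler_pM; rewrite ?mulr_ge0 ?powR_ge0//; [lra| |exact: mono].
  by apply: ler_wpM2l; [lra|exact: mono].
have LE : 4 `^ s * Psi `^ s * Rmax `^ s = K0 * P `^ (s * (2 * k%:R * e1 + eta)).
  rewrite /Psi /Rmax powRM ?powR_ge0//; last by lra.
  by rewrite -!powRrM /K0 mulrDr powD ![s * _]mulrC; ring.
have LE4 : 4 `^ s * Psi `^ s * Rmax `^ s <= 2^-1 * P `^ (delta / 2).
  rewrite LE; have -> : delta / 2 = delta / 4 + delta / 4 by field.
  rewrite [in leRHS]powD [leRHS]mulrA; apply: ler_pM; [exact: ltW|exact: powR_ge0| |].
    rewrite mulrC ler_pdivlMr// mulrC; apply: powK; first by rewrite divr_gt0.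
      by apply: mulr_ge0 => //; exact: ltW.
    by rewrite invf_div.
  apply: ler_powR => //.
  exact: exponent_le.
have Yh : P `^ (delta / 2) = Y `^ 2^-1 by rewrite /Y -powRrM.
(* With c = 1/2 the gain Y^c is P^(delta/2), which [LE4] shows to be at least twice the loss of a
   pass. *)
have LY : 4 `^ s * Psi `^ s * Rmax `^ s * Y `^ (- 2^-1) <= 2^-1.
  have Yh0 : 0 < Y `^ 2^-1 := powR_gt0 _ Y0.
  rewrite [Y `^ (- _)]powRN (ler_pdivrMr _ _ Yh0) -Yh.
  exact: LE4.
have h2 : (0 : R) <= 2^-1 by rewrite invr_ge0.
have := arcsum_bound R k s Delta 2^-1 P Y Rmax Psi B0 k0 s1 Dks eD h2 Y1 Rmax1 Psi1 B00 U_bound Psi_bound LY Q P Rr Q1 R1 RP YP (lexx P) zP4.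
rewrite zD; move=> /le_trans; apply.
set L := 4 `^ s * _ * _ in LE4 *; set A1 := 3 * B0 * _.
rewrite -[leLHS]mulrA [leRHS]mulrA; apply: ler_wpM2r => //.
have A1b : A1 <= 3 * C0' * 4 `^ `|Delta| * P `^ (eps / 2 + 2 * delta * `|Delta|).
  rewrite /A1 /B0; have RY : (4 * Rmax * Y) `^ `|Delta| <= 4 `^ `|Delta| * P `^ (2 * delta * `|Delta|).
    have -> : P `^ (2 * delta * `|Delta|) = (Y * Y) `^ `|Delta|.
      by rewrite /Y -powD -powRrM; congr (_ `^ _); ring.
    rewrite -powRM ?mulr_ge0 ?(ltW Y0)//; apply: ge0_ler_powR; rewrite ?nnegrE//.
    - by rewrite !mulr_ge0 ?(ltW Y0) ?(le_trans ler01 Rmax1).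
    - by rewrite !mulr_ge0 ?(ltW Y0).
    - by rewrite -mulrA; apply: ler_wpM2l => //; apply: ler_wpM2r => //; exact: ltW.
  have c0 : 0 <= 3 * (C0' * P `^ (eps / 2)) := mulr_ge0 (ler0n _ 3) B00.
  apply: (le_trans (ler_wpM2l c0 RY)); rewrite powD le_eqVlt; apply/orP; left; apply/eqP; ring.
have A10 : 0 <= A1 := mulr_ge0 (mulr_ge0 (ler0n _ 3) B00) (powR_ge0 _ _).
have L0 : 0 <= L := mulr_ge0 (mulr_ge0 (powR_ge0 _ _) (powR_ge0 _ _)) (powR_ge0 _ _).
have LYb : L * Y <= 2^-1 * P `^ (2 * delta).
  apply: (@le_trans _ _ (2^-1 * P `^ (delta / 2) * Y)); first by apply: ler_wpM2r; [exact: ltW|].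
  exact: half_power_le (ltW delta0).
have P2d : 1 <= P `^ (2 * delta) by apply: powR_ge1 => //; exact: mulr_ge0 (ler0n _ 2) (ltW delta0).
have PA : P `^ (2 * delta) * A1 <= 3 * C0' * 4 `^ `|Delta| * P `^ eps.
  apply: (le_trans (ler_wpM2l (powR_ge0 _ _) A1b)).
  apply: (@le_trans _ _ (3 * C0' * 4 `^ `|Delta| * P `^ (2 * delta + (eps / 2 + 2 * delta * `|Delta|)))).
    by rewrite [in leRHS]powD le_eqVlt; apply/orP; left; apply/eqP; ring.
  apply: ler_wpM2l; last exact: ler_powR.
  exact: mulr_ge0 (mulr_ge0 (ler0n _ 3) (le_trans ler01 C01)) t4.
exact: (constant_le R _ L Y _ A1 C0' _ _ t2 A10 P2d Pe LYb PA).
Qed.
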